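(* Let $\mathcal X$ be a subset of $\mathcal E$ for which $A_{\mathcal X}$ is benign in the free group $F_3=\langle a,b,c\rangle$. Then the $2$-generator group $T_{\mathcal X}=\langle x,y\mid w_f(x,y)=1,\ f\in\mathcal X\rangle$ can be embedded into a finitely presented group $\mathcal G$. Moreover, if a finitely presented overgroup $K_{\mathcal X}$ of $F_3$ and its finitely generated subgroup $L_{\mathcal X}$ with $F_3\cap L_{\mathcal X}=A_{\mathcal X}$ are given explicitly, then $\mathcal G$ can also be given explicitly.
   Context: $\mathcal E$ is the set of all functions $f:\mathbb Z\to\mathbb Z$ with finite support. Conjugation is $u^v=v^{-1}uv$. In the free group $F_3=\langle a,b,c\rangle$ of rank $3$ put $b_i=b^{c^i}$ for $i\in\mathbb Z$, and for $f\in\mathcal E$ put $b_f=\cdots b_{-1}^{f(-1)}b_0^{f(0)}b_1^{f(1)}\cdots$ (indices increasing from left to right) and $a_f=a^{b_f}$. For $\mathcal X\subseteq\mathcal E$ put $A_{\mathcal X}=\langle a_f\mid f\in\mathcal X\rangle\le F_3$. A subgroup $H$ of a finitely generated group $G$ is benign in $G$ if $G$ can be embedded into a finitely presented group $K$ having a finitely generated subgroup $L\le K$ with $G\cap L=H$; for $H=A_{\mathcal X}$, $G=F_3$ such $K,L$ are denoted $K_{\mathcal X},L_{\mathcal X}$. For $f\in\mathcal E$ the word $w_f(x,y)$ in the free group $\langle x,y\rangle$ of rank $2$ is $w_f(x,y)=\cdots y^{f(-1)}x^{f(0)}y^{f(1)}x^{f(2)}\cdots$, i.e. the product over $i\in\mathbb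 Z$ in increasing order of $x^{f(i)}$ for even $i$ and $y^{f(i)}$ for odd $i$. For example, if $f(0)=3$, $f(1)=5$, $f(2)=2$ and $f$ vanishes elsewhere, then $w_f(x,y)=x^3y^5x^2$. A finitely presented group is given explicitly if finite lists of its generators and defining relations are written down; a finitely generated subgroup is given explicitly by words representing its generators; the embedding $F_3\le K_{\mathcal X}$ is given by words for $a,b,c$. ''Can also be given explicitly'' means that a finite presentation of $\mathcal G$ can be effectively written down from the data for $K_{\mathcal X},L_{\mathcal X}$. *)

(* Defs.v *)
From HB Require Import structures.
From mathcomp Require Import all_boot all_order all_algebra.
From mathcomp Require Import generic_quotient finmap.
From mathcomp Require Import boolp classical_sets.

Set Implicit Arguments.
Unset Strict Implicit.
Unset Printing Implicit Defensive.

Local Open Scope classical_set_scope.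
Local Open Scope quotient_scope.
Local Open Scope group_scope.

(* The letter [(i, false)] stands for the generator [i], and [(i, true)] for
   its inverse; words need not be reduced. *)
Notation word I := (seq (I * bool)).

Section PresentedGroup.
Variables (I : choiceType) (R : set (word I)).
Implicit Types u v w : word I.

Definition inv_letter (l : I * bool) : I * bool := (l.1, ~~ l.2).
Definition inv_word u : word I := rev (map inv_letter u).

Inductive pres_eq : word I -> word I -> Prop :=
  | pres_eq_refl u : pres_eq u u
  | pres_eq_sym u v : pres_eq u v -> pres_eq v u
  | pres_eq_trans u v w : pres_eq u v -> pres_eq v w -> pres_eq u w
  | pres_eq_cancel u v l : pres_eq (u ++ [:: l; inv_letter l] ++ v) (u ++ v)
  | pres_eq_relator u v r : R r -> pres_eq (u ++ r ++ v) (u ++ v).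

Definition pres_eqb u v := `[< pres_eq u v >].

Lemma pres_eqb_equiv : equiv_class_of pres_eqb.
Proof.
split=> [u|u v|v u w].
- by apply/asboolP; exact: pres_eq_refl.
- by apply/asboolP/asboolP; exact: pres_eq_sym.
- by move=> /asboolP uv /asboolP vw; apply/asboolP; exact: pres_eq_trans vw.
Qed.

Canonical pres_equiv := EquivRelPack pres_eqb_equiv.

(* The group < I | r = 1, r in R >. *)
Definition pres_group := {eq_quot pres_equiv}.

HB.instance Definition _ := Choice.on pres_group.
HB.instance Definition _ := EqQuotient.on pres_group.

Definition word_class u : pres_group := \pi_pres_group u.

Lemma word_classP u v : word_class u = word_class v <-> pres_eq u v.
Proof.
rewrite /word_class; split=> [/eqmodP/asboolP //|uv].
by apply/eqmodP/asboolP.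
Qed.

Lemma word_class_repr (x : pres_group) : word_class (repr x) = x.
Proof. exact: reprK. Qed.

Lemma pres_eq_cat u u' v v' :
  pres_eq u u' -> pres_eq v v' -> pres_eq (u ++ v) (u' ++ v').
Proof.
have cat2l w v1 v2 : pres_eq v1 v2 -> pres_eq (w ++ v1) (w ++ v2).
  elim=> {v1 v2} [v1|v1 v2 _|v1 v2 v3 _ h1 _ h2|v1 v2 l|v1 v2 r Rr].
  - exact: pres_eq_refl.
  - exact: pres_eq_sym.
  - exact: pres_eq_trans h2.
  - by rewrite 2!(catA w); exact: pres_eq_cancel.
  - by rewrite 2!(catA w); exact: pres_eq_relator.
have cat2r w v1 v2 : pres_eq v1 v2 -> pres_eq (v1 ++ w) (v2 ++ w).
  elim=> {v1 v2} [v1|v1 v2 _|v1 v2 v3 _ h1 _ h2|v1 v2 l|v1 v2 r Rr].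
  - exact: pres_eq_refl.
  - exact: pres_eq_sym.
  - exact: pres_eq_trans h2.
  - by rewrite -!catA; exact: pres_eq_cancel.
  - by rewrite -!catA; exact: pres_eq_relator.
by move=> uu' vv'; apply: pres_eq_trans (cat2l _ _ _ vv'); exact: cat2r.
Qed.

Lemma inv_letterK : involutive inv_letter.
Proof. by case=> i b; rewrite /inv_letter negbK. Qed.

Lemma inv_wordK : involutive inv_word.
Proof.
by move=> u; rewrite /inv_word map_rev revK -map_comp map_id_in // => l _ /=;
   exact: inv_letterK.
Qed.

Lemma pres_eq_mulV u : pres_eq (u ++ inv_word u) [::].
Proof.
elim: u => [|l u IHu]; first exact: pres_eq_refl.
rewrite /inv_word /= rev_cons -cats1.
apply: pres_eq_trans (pres_eq_cancel [::] [::] l).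
rewrite (_ : l :: u ++ _ = [:: l] ++ (u ++ inv_word u) ++ [:: inv_letter l]).
  apply: (@pres_eq_cat [:: l] [:: l]); first exact: pres_eq_refl.
  by apply: (@pres_eq_cat _ [::]) => //; exact: pres_eq_refl.
by rewrite /= catA.
Qed.

Lemma pres_eq_Vmul u : pres_eq (inv_word u ++ u) [::].
Proof. by rewrite -{2}(inv_wordK u); exact: pres_eq_mulV. Qed.

Lemma pres_eq_inv u v : pres_eq u v -> pres_eq (inv_word u) (inv_word v).
Proof.
move=> uv; have refl w := pres_eq_refl w.
have /pres_eq_sym h : pres_eq (inv_word u ++ v ++ inv_word v) (inv_word u).
  rewrite -[X in pres_eq _ X]cats0.
  by apply: pres_eq_cat => //; exact: pres_eq_mulV.
apply: pres_eq_trans h _; rewrite catA -[X in pres_eq _ X]cat0s.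
apply: pres_eq_cat => //; apply: pres_eq_trans (pres_eq_Vmul u).
by apply: pres_eq_cat => //; exact: pres_eq_sym.
Qed.

Definition pres_mul (x y : pres_group) := word_class (repr x ++ repr y).
Definition pres_one := word_class [::].
Definition pres_inv (x : pres_group) := word_class (inv_word (repr x)).

Lemma pres_eq_repr u : pres_eq (repr (word_class u)) u.
Proof. by apply/word_classP; rewrite word_class_repr. Qed.

Lemma pres_mulE u v :
  pres_mul (word_class u) (word_class v) = word_class (u ++ v).
Proof. by apply/word_classP; apply: pres_eq_cat; exact: pres_eq_repr. Qed.

Lemma pres_invE u : pres_inv (word_class u) = word_class (inv_word u).
Proof. by apply/word_classP; apply: pres_eq_inv; exact: pres_eq_repr. Qed.

Lemma pres_mulA : associative pres_mul.
Proof.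
move=> x y z; rewrite -(word_class_repr x) -(word_class_repr y).
by rewrite -(word_class_repr z) !pres_mulE catA.
Qed.

Lemma pres_mul1 : left_id pres_one pres_mul.
Proof. by move=> x; rewrite -(word_class_repr x) pres_mulE. Qed.

Lemma pres_mulr1 : right_id pres_one pres_mul.
Proof. by move=> x; rewrite -(word_class_repr x) pres_mulE cats0. Qed.

Lemma pres_mulVx : left_inverse pres_one pres_inv pres_mul.
Proof.
move=> x; rewrite -(word_class_repr x) pres_invE pres_mulE.
by apply/word_classP; exact: pres_eq_Vmul.
Qed.

Lemma pres_mulxV : right_inverse pres_one pres_inv pres_mul.
Proof.
move=> x; rewrite -(word_class_repr x) pres_invE pres_mulE.
by apply/word_classP; exact: pres_eq_mulV.
Qed.

HB.instance Definition _ := isGroup.Build pres_group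
  pres_mulA pres_mul1 pres_mulr1 pres_mulVx pres_mulxV.

Definition pres_gen (i : I) : pres_group := word_class [:: (i, false)].

End PresentedGroup.

Arguments word_class {I R} u.
Arguments pres_gen {I R} i.

Definition free_group (I : choiceType) : groupType := pres_group (@set0 (word I)).

Section Groups.
Variable G : groupType.

Definition expgz (x : G) (m : int) : G :=
  match m with Posz n => x ^+ n | Negz n => x ^- n.+1 end.

Definition is_subgroup (H : set G) :=
  H 1 /\ forall x y, H x -> H y -> H (x * y^-1).

Definition subgroup_gen (S : set G) : set G := smallest is_subgroup S.

Definition fg_subgroup (H : set G) :=
  exists s : seq G, H = subgroup_gen [set x | x \in s].

End Groups.

Definition embeds (G H : groupType) :=
  exists phi : {multiplicative G -> H}, injective phi.

Definition isomorphic (G H : groupType) :=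
  exists phi : {multiplicative G -> H}, bijective phi.

(* The generators are indexed by ['I_n]; the second component lists the
   relators. *)
Definition fin_pres := {n : nat & seq (word 'I_n)}.

(* [pickle] is a computable Goedel numbering of presentations: naturals and
   ordinals are coded by their value, booleans by 0 and 1, and lists and
   (dependent) pairs by [CodeSeq.code]. *)
HB.instance Definition _ := Countable.copy fin_pres
  {n : nat & seq (word 'I_n)}.

Definition group_of (P : fin_pres) : groupType :=
  pres_group [set r | r \in tagged P].

Definition finitely_presented (G : groupType) :=
  exists P : fin_pres, isomorphic G (group_of P).

Definition benign (G : groupType) (H : set G) :=
  exists (K : groupType) (phi : {multiplicative G -> K}) (L : set K),
    [/\ finitely_presented K, fg_subgroup L, injective phi &
        phi @` H = range phi `&` L].

Definition E : Type := {fsfun int -> int with 0%R}.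

Definition isupp (f : E) : seq int := sort <=%R (finsupp f).

Definition F3 : groupType := free_group 'I_3.
Definition F3a : F3 := pres_gen (inord 0).
Definition F3b : F3 := pres_gen (inord 1).
Definition F3c : F3 := pres_gen (inord 2).

Definition b_ (i : int) : F3 := F3b ^ expgz F3c i.
Definition b_fun (f : E) : F3 := \prod_(i <- isupp f) expgz (b_ i) (f i).
Definition a_fun (f : E) : F3 := F3a ^ b_fun f.
Definition A_ (X : set E) : set F3 := subgroup_gen (a_fun @` X).

Definition word_exp (I : Type) (i : I) (m : int) : word I :=
  match m with
  | Posz n => nseq n (i, false)
  | Negz n => nseq n.+1 (i, true)
  end.

(* [x] is the letter [0 : 'I_2] and [y] is [1 : 'I_2]. *)
Definition w_ (f : E) : word 'I_2 :=
  flatten [seq word_exp (inord (odd `|i|%N)) (f i) | i <- isupp f].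

Definition T_ (X : set E) : groupType := pres_group (w_ @` X).

(* Codes of partial recursive (mu-recursive) functions.  Arguments are passed
   as a list; [MuSucc] and [MuProj] read a missing argument as 0. *)
Inductive mu_code : Type :=
  | MuZero
  | MuSucc
  | MuProj of nat
  | MuComp of mu_code & seq mu_code
  | MuPrec of mu_code & mu_code
  | MuMin of mu_code.

(* [mu_eval e v y]: the computation of [e] on [v] halts with value [y]. *)
Inductive mu_eval : mu_code -> seq nat -> nat -> Prop :=
  | mu_eval_zero v : mu_eval MuZero v 0
  | mu_eval_succ v : mu_eval MuSucc v (nth 0 v 0).+1
  | mu_eval_proj i v : mu_eval (MuProj i) v (nth 0 v i)
  | mu_eval_comp f gs v w y :
      mu_evals gs v w -> mu_eval f w y -> mu_eval (MuComp f gs) v y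
  | mu_eval_prec0 f g v y :
      mu_eval f v y -> mu_eval (MuPrec f g) (0 :: v) y
  | mu_eval_precS f g n v z y :
      mu_eval (MuPrec f g) (n :: v) z -> mu_eval g (n :: z :: v) y ->
      mu_eval (MuPrec f g) (n.+1 :: v) y
  | mu_eval_min f v n (k : nat -> nat) :
      (forall m, m < n -> mu_eval f (m :: v) (k m).+1) ->
      mu_eval f (n :: v) 0 -> mu_eval (MuMin f) v n
with mu_evals : seq mu_code -> seq nat -> seq nat -> Prop :=
  | mu_evals_nil v : mu_evals [::] v [::]
  | mu_evals_cons g gs v y w :
      mu_eval g v y -> mu_evals gs v w -> mu_evals (g :: gs) v (y :: w).

(* Explicit data for a finitely presented overgroup of F3 and a finitely
   generated subgroup of it, over a common number [n] of generators: the
   relators of the overgroup, the words for a, b, c, and the words generating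
   the subgroup. *)
Definition explicit_data :=
  {n : nat & (seq (word 'I_n) * 3.-tuple (word 'I_n) * seq (word 'I_n))%type}.

HB.instance Definition _ := Countable.copy explicit_data
  {n : nat & (seq (word 'I_n) * 3.-tuple (word 'I_n) * seq (word 'I_n))%type}.

Definition data_pres (D : explicit_data) : fin_pres :=
  Tagged (fun n => seq (word 'I_n)) (tagged D).1.1.

Definition data_emb (D : explicit_data) (i : 'I_3) : group_of (data_pres D) :=
  word_class (tnth (tagged D).1.2 i).

Definition data_sub (D : explicit_data) : set (group_of (data_pres D)) :=
  subgroup_gen [set word_class w | w in [set w | w \in (tagged D).2]].

Arguments data_emb : clear implicits.
Arguments data_sub : clear implicits.

Definition explicit_for (D : explicit_data) (H : set F3) :=
  exists phi : {multiplicative F3 -> group_of (data_pres D)},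
    [/\ injective phi, forall i : 'I_3, phi (pres_gen i) = data_emb D i &
        phi @` H = range phi `&` data_sub D].

(* Main.v *)
(* Let K contain F3 = <a, b, c> and let L meet F3 in A_X.  Adjoin to K letters
   t, s, al, x, y, d, x', y' such that t centralizes L; d interchanges x and y;
   x, y commute with x', y' and x^al = x x', y^al = y y'; al, x, d commute with
   a, b, c, and al with t; finally s multiplies a, b, c by al, x, d and
   a^t, b^t, c^t by al, 1, 1.  For f in X the element a_f = a_f^t lies in L, so
   that al^{w_f(x, y)} = al on comparing the two effects of s; conjugating
   w_f(x, y) by al then yields w_f(x', y') = 1.  All these relations are finitely
   many, hence T_X maps to a finitely presented group by x, y |-> x', y'.

   The map is injective because the relations have a model in which x', y'
   generate T_X: permutations of a set S * T_X^3, where al, x, y, d, x', y' move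
   only the second factor and K and t only the first.  The letter s acts through
   an F3-equivariant map from S to the permutations of T_X^3, and t is obtained
   from an L-equivariant Cantor-Bernstein argument; no normal form theorem for
   HNN extensions or amalgams is involved. *)

Require Import Defs.
From Stdlib Require List.
From HB Require Import structures.
From mathcomp Require Import all_boot all_order all_algebra.
From mathcomp Require Import boolp classical_sets.

Set Implicit Arguments.
Unset Strict Implicit.
Unset Printing Implicit Defensive.

Local Open Scope classical_set_scope.
Local Open Scope group_scope.

(** * Words, presentations and the rope relations *)

Section GroupMorphisms.
Variables (G H : groupType) (f : {multiplicative G -> H}).

Lemma group_morph1 : f 1 = 1.
Proof. by apply: (@mulgI _ (f 1)); rewrite -gmulfM !mulg1. Qed.

Lemma group_morphV : {morph f : x / x^-1}.
Proof. by move=> x; apply: (@mulgI _ (f x)); rewrite -gmulfM !mulgV group_morph1. Qed.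

Lemma group_morphJ : {morph f : x y / x ^ y}.
Proof. by move=> x y; rewrite !conjgE !gmulfM group_morphV. Qed.

Lemma group_morphX n : {morph f : x / x ^+ n}.
Proof.
by move=> x; elim: n => [|n IHn]; rewrite ?expg0 ?group_morph1 // !expgS gmulfM IHn.
Qed.

Lemma group_morph_prod (I : Type) (s : seq I) (F : I -> G) :
  f (\prod_(i <- s) F i) = \prod_(i <- s) f (F i).
Proof. exact: (big_morph f (@gmulfM _ _ f) group_morph1). Qed.

Lemma group_morph_expgz m : {morph f : x / expgz x m}.
Proof. by case: m => n x /=; rewrite ?group_morphV group_morphX. Qed.

End GroupMorphisms.

Lemma mulgACA_commute (G : groupType) (x y z t : G) :
  commute y z -> (x * y) * (z * t) = (x * z) * (y * t).
Proof. by move=> yz; rewrite mulgA -(mulgA x) yz !mulgA. Qed.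

Section WordEvaluation.
Variables (I : choiceType) (G : groupType).
Implicit Types (g : I -> G) (u v w : word I).

Definition letter_eval g (l : I * bool) : G := if l.2 then (g l.1)^-1 else g l.1.

Definition word_eval g w : G := \prod_(l <- w) letter_eval g l.

Lemma word_eval_nil g : word_eval g [::] = 1.
Proof. by rewrite /word_eval big_nil. Qed.

Lemma word_eval_cons g l w : word_eval g (l :: w) = letter_eval g l * word_eval g w.
Proof. by rewrite /word_eval big_cons. Qed.

Lemma word_eval_cat g u v : word_eval g (u ++ v) = word_eval g u * word_eval g v.
Proof. by rewrite /word_eval big_cat. Qed.

Lemma letter_eval_inv g l : letter_eval g (inv_letter l) = (letter_eval g l)^-1.
Proof. by case: l => i [] /=; rewrite /letter_eval /= ?invgK. Qed.

Lemma word_eval_inv g u : word_eval g (inv_word u) = (word_eval g u)^-1.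
Proof.
elim: u => [|l u IHu]; first by rewrite word_eval_nil invg1.
rewrite /inv_word /= rev_cons -cats1 word_eval_cat [word_eval g (rev _)]IHu.
by rewrite !word_eval_cons word_eval_nil mulg1 letter_eval_inv invgM.
Qed.

Lemma word_eval_exp g i m : word_eval g (word_exp i m) = expgz (g i) m.
Proof.
have eval_nseq n b : word_eval g (nseq n (i, b)) = letter_eval g (i, b) ^+ n.
  elim: n => [|n IHn]; first by rewrite word_eval_nil.
  by rewrite word_eval_cons IHn expgS.
by case: m => n; rewrite /word_exp eval_nseq ?expVgn.
Qed.

Lemma eq_word_eval g g' w : g =1 g' -> word_eval g w = word_eval g' w.
Proof. by move=> gg'; apply: eq_bigr => l _; rewrite /letter_eval gg'. Qed.

End WordEvaluation.

Lemma word_eval_map (I J : choiceType) (G : groupType) (h : I -> J) (g : J -> G) (w : word I) :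
  word_eval g [seq (h l.1, l.2) | l <- w] = word_eval (g \o h) w.
Proof. by rewrite /word_eval big_map. Qed.

Lemma morph_word_eval (I : choiceType) (G H : groupType) (phi : {multiplicative G -> H})
    (g : I -> G) (w : word I) :
  phi (word_eval g w) = word_eval (phi \o g) w.
Proof.
rewrite /word_eval group_morph_prod; apply: eq_bigr => l _.
by rewrite /letter_eval; case: l.2; rewrite ?group_morphV.
Qed.

Section PresentedGroupTheory.
Variables (I : choiceType) (R : set (word I)).

Lemma word_class_eval w : word_class w = word_eval (@pres_gen I R) w.
Proof.
elim: w => [|l w IHw]; first by rewrite word_eval_nil.
rewrite word_eval_cons -IHw -cat1s -pres_mulE; congr (_ * _).
case: l => i []; rewrite /letter_eval //=.
by rewrite [(pres_gen i)^-1](@pres_invE I R [:: (i, false)]).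
Qed.

Lemma relator_eval r : R r -> word_eval (@pres_gen I R) r = 1.
Proof.
move=> Rr; rewrite -word_class_eval; apply/word_classP.
by have := pres_eq_relator [::] [::] Rr; rewrite cats0.
Qed.

Lemma pres_group_ind (P : pres_group R -> Prop) :
  P 1 -> (forall i x, P x -> P (pres_gen i * x)) ->
  (forall i x, P x -> P ((pres_gen i)^-1 * x)) -> forall x, P x.
Proof.
move=> P1 Pgen PgenV x; rewrite -(word_class_repr x) word_class_eval.
elim: (repr x) => [|[i b] w IHw]; first by rewrite word_eval_nil.
by rewrite word_eval_cons; case: b; [exact: PgenV | exact: Pgen].
Qed.

Variable G : groupType.

(** Von Dyck's theorem: evaluation is constant on the classes of [pres_eq], so it may be computed on
    the representative [repr x]. *)
Lemma pres_group_lift (g : I -> G) :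
  (forall r, R r -> word_eval g r = 1) ->
  exists phi : {multiplicative pres_group R -> G},
    forall i, phi (pres_gen i) = g i.
Proof.
move=> gR.
have eval_eq u v : pres_eq R u v -> word_eval g u = word_eval g v.
  elim=> {u v} [//|//|u v w _ -> _ -> //|u v l|u v r Rr]; rewrite !word_eval_cat.
    by rewrite !word_eval_cons word_eval_nil mulg1 letter_eval_inv mulgV mul1g.
  by rewrite (gR r Rr) mul1g.
pose f (x : pres_group R) := word_eval g (repr x).
have fE w : f (word_class w) = word_eval g w by apply: eval_eq; exact: pres_eq_repr.
have fM : {morph f : x y / x * y}.
  move=> x y; rewrite -(word_class_repr x) -(word_class_repr y).
  by rewrite [_ * _]pres_mulE !fE word_eval_cat.
pose fmul := isMultiplicative.Build _ _ f fM.
pose phi : {multiplicative pres_group R -> G} := HB.pack f fmul.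
exists phi => i /=.
by rewrite fE word_eval_cons word_eval_nil mulg1.
Qed.

Lemma pres_morph_eq (phi psi : {multiplicative pres_group R -> G}) :
  (forall i, phi (pres_gen i) = psi (pres_gen i)) -> phi =1 psi.
Proof.
move=> gens; elim/pres_group_ind => [|i x IHx|i x IHx]; first by rewrite !group_morph1.
  by rewrite !gmulfM gens IHx.
by rewrite !gmulfM !group_morphV gens IHx.
Qed.

Lemma pres_morph_commute (phi : {multiplicative pres_group R -> G}) z :
  (forall i, commute z (phi (pres_gen i))) -> forall x, commute z (phi x).
Proof.
move=> gens; elim/pres_group_ind => [|i x IHx|i x IHx].
- by rewrite group_morph1; exact: commute1.
- by rewrite gmulfM; exact: commuteM.
- by rewrite gmulfM group_morphV; apply: commuteM => //; exact: commuteV.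
Qed.

(* The device behind every use of the "rope": a conjugation which multiplies
   the generators by commuting elements multiplies all words accordingly. *)
Lemma conj_pres_morph (phi chi : {multiplicative pres_group R -> G}) t s :
  (forall i j, commute (phi (pres_gen i) ^ t) (chi (pres_gen j))) ->
  (forall i, (phi (pres_gen i) ^ t) ^ s = phi (pres_gen i) ^ t * chi (pres_gen i)) ->
  forall x, (phi x ^ t) ^ s = phi x ^ t * chi x.
Proof.
move=> comm gens; have commx i x : commute (phi (pres_gen i) ^ t) (chi x).
  exact: pres_morph_commute.
have cx x i : commute (phi x ^ t) (chi (pres_gen i)).
  apply: commute_sym; move: x; elim/pres_group_ind => [|j x IHx|j x IHx].
  - by rewrite group_morph1 conj1g; exact: commute1.
  - rewrite gmulfM conjMg; apply: commuteM => //; exact: commute_sym.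
  - rewrite gmulfM group_morphV conjMg conjVg; apply: commuteM => //.
    by apply/commuteV/commute_sym.
elim/pres_group_ind => [|i x IHx|i x IHx]; first by rewrite !group_morph1 !conj1g mulg1.
  by rewrite !gmulfM (conjMg _ _ t) (conjMg _ _ s) IHx gens; apply/mulgACA_commute/commute_sym/cx.
rewrite !gmulfM !group_morphV (conjMg _ _ t) (conjMg _ _ s) IHx.
rewrite (conjVg _ t) (conjVg _ s) gens comm invgM.
by apply/mulgACA_commute/commute_sym/commuteV/cx.
Qed.

End PresentedGroupTheory.

Lemma free_group_lift (I : choiceType) (G : groupType) (g : I -> G) :
  exists phi : {multiplicative free_group I -> G}, forall i, phi (pres_gen i) = g i.
Proof. exact: pres_group_lift. Qed.

Section Subgroups.
Variable G : groupType.

Lemma is_subgroupM (H : set G) x y : is_subgroup H -> H x -> H y -> H (x * y).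
Proof.
move=> [H1 HD] Hx Hy; rewrite -(invgK y); apply: (HD) => //.
by rewrite -(mul1g y^-1); exact: HD.
Qed.

Lemma is_subgroupV (H : set G) x : is_subgroup H -> H x -> H x^-1.
Proof. by move=> [H1 HD] Hx; rewrite -(mul1g x^-1); exact: HD. Qed.

Lemma subgroup_gen_is_subgroup (S : set G) : is_subgroup (subgroup_gen S).
Proof.
split=> [B [[B1 _] _]//|x y Sx Sy B BS].
by have [[_ BD] _] := BS; apply: BD; [exact: Sx | exact: Sy].
Qed.

Lemma sub_subgroup_gen (S : set G) : S `<=` subgroup_gen S.
Proof. by move=> x Sx B [_]; exact. Qed.

Lemma subgroup_gen_min (S H : set G) :
  is_subgroup H -> S `<=` H -> subgroup_gen S `<=` H.
Proof. by move=> sgH SH x; apply. Qed.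

Lemma commute_subgroup (H : groupType) (phi : {multiplicative G -> H}) z :
  is_subgroup [set x | commute z (phi x)].
Proof.
split=> [|x y zx zy] /=; first by rewrite group_morph1; exact: commute1.
by rewrite gmulfM group_morphV; apply: commuteM => //; exact: commuteV.
Qed.

Lemma equalizer_subgroup (H : groupType) (phi psi : {multiplicative G -> H}) :
  is_subgroup [set x | phi x = psi x].
Proof.
split=> [|x y /= xE yE]; first by rewrite /= !group_morph1.
by rewrite /= !gmulfM !group_morphV xE yE.
Qed.

End Subgroups.

(** * The rope relations and the words they make trivial *)

Definition pair2 (G : Type) (x y : G) (i : 'I_2) : G := if i == ord0 then x else y.

Lemma conj_swap_expgz (G : groupType) (x y d : G) m :
  x ^ d = y -> y ^ d = x -> x ^ expgz d m = if odd `|m|%N then y else x.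
Proof.
move=> xd yd; have conj_nat n : x ^ (d ^+ n) = if odd n then y else x.
  elim: n => [|n IHn]; first by rewrite conjg1.
  by rewrite expgSr conjgM IHn /=; case: (odd n).
case: m => n /=; first exact: conj_nat.
(* A negative exponent is removed by conjugating both sides with the opposite positive power; parity
   does not see the sign. *)
apply: (@conjg_inj _ (d ^+ n.+1)); rewrite -conjgM mulVg conjg1.
have yn k : y ^ (d ^+ k) = if odd k then x else y.
  by rewrite -xd -conjgM -expgS conj_nat /= xd; case: (odd k).
case: ifPn => [|] /=; rewrite ?yn ?conj_nat /=; first by move=> ->.
by move=> /negbTE ->.
Qed.

(* Since d interchanges x and y, the elements b_i = b^(c^i) are sent
   alternately to x and to y. *)
Lemma morph_b_fun (G : groupType) (chi : {multiplicative F3 -> G}) (x y : G) f :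
  chi F3b = x -> x ^ chi F3c = y -> y ^ chi F3c = x ->
  chi (b_fun f) = word_eval (pair2 x y) (w_ f).
Proof.
move=> bx xd yd; rewrite /b_fun group_morph_prod /w_.
elim: (isupp f) => [|i s IHs]; first by rewrite big_nil word_eval_nil.
rewrite big_cons /= word_eval_cat IHs word_eval_exp group_morph_expgz; congr (expgz _ _ * _).
rewrite /b_ group_morphJ group_morph_expgz bx (conj_swap_expgz i xd yd) /pair2.
rewrite -val_eqE /= inordK; first by case: (odd _).
by case: (odd _).
Qed.

Notation letter k := (inord k%N : 'I_11, false).
Notation letterV k := (inord k%N : 'I_11, true).

(* The letters stand for a, b, c, t, s, al, x, y, d, x', y' in this order. *)
Definition rope_eqs : seq (word 'I_11 * word 'I_11) :=
  [seq ([:: letter p.1; letter p.2], [:: letter p.2; letter p.1])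
     | p <- [:: (5, 0); (5, 1); (5, 2); (6, 0); (6, 1); (6, 2); (8, 0); (8, 1);
                (8, 2); (5, 3); (6, 9); (6, 10); (7, 9); (7, 10)]%N] ++
  [:: ([:: letter 0; letter 4], [:: letter 4; letter 0; letter 5]);
      ([:: letter 1; letter 4], [:: letter 4; letter 1; letter 6]);
      ([:: letter 2; letter 4], [:: letter 4; letter 2; letter 8]);
      ([:: letterV 3; letter 0; letter 3; letter 4],
       [:: letter 4; letterV 3; letter 0; letter 3; letter 5]);
      ([:: letterV 3; letter 1; letter 3; letter 4],
       [:: letter 4; letterV 3; letter 1; letter 3]);
      ([:: letterV 3; letter 2; letter 3; letter 4],
       [:: letter 4; letterV 3; letter 2; letter 3]);
      ([:: letter 6; letter 8], [:: letter 8; letter 7]);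
      ([:: letter 7; letter 8], [:: letter 8; letter 6]);
      ([:: letter 6; letter 5], [:: letter 5; letter 6; letter 9]);
      ([:: letter 7; letter 5], [:: letter 5; letter 7; letter 10])].

Definition rope_holds (G : groupType) (g : 'I_11 -> G) :=
  all (fun e => word_eval g e.1 == word_eval g e.2) rope_eqs.

Record rope (G : groupType) (a b c t s al x y d x' y' : G) : Prop := Rope {
  rope_al : [/\ commute al a, commute al b, commute al c & commute al t];
  rope_x : [/\ commute x a, commute x b & commute x c];
  rope_d : [/\ commute d a, commute d b & commute d c];
  rope_xy' : [/\ commute x x', commute x y', commute y x' & commute y y'];
  rope_s : [/\ a ^ s = a * al, b ^ s = b * x & c ^ s = c * d];
  rope_ts : [/\ (a ^ t) ^ s = a ^ t * al, (b ^ t) ^ s = b ^ t & (c ^ t) ^ s = c ^ t];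
  rope_swap : x ^ d = y /\ y ^ d = x;
  rope_graph : x ^ al = x * x' /\ y ^ al = y * y'
}.

Lemma conjg_eqE (G : groupType) (x y z : G) : (x ^ y == z) = (x * y == y * z).
Proof. by rewrite conjgC; apply/eqP/eqP => [->//|/mulgI]. Qed.

Lemma conjg_intro (G : groupType) (x y z : G) : x * y = y * z -> x ^ y = z.
Proof. by move=> xy; apply/eqP; rewrite conjg_eqE xy. Qed.

(** The list form supplies relators, the record is the form used in calculations. A conjugation
    relation [u ^ v = w] is listed as [u v = v w]. *)
Lemma rope_holdsP (G : groupType) (g : 'I_11 -> G) (e := fun k => g (inord k)) :
  rope_holds g <->
  rope (e 0) (e 1%N) (e 2) (e 3) (e 4) (e 5) (e 6) (e 7) (e 8) (e 9) (e 10).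
Proof.
rewrite /rope_holds /rope_eqs /= !word_eval_cons !word_eval_nil /letter_eval /=.
rewrite !mulg1 -/(e 0) -/(e 1%N) -/(e 2) -/(e 3) -/(e 4) -/(e 5) -/(e 6) -/(e 7).
rewrite -/(e 8) -/(e 9) -/(e 10) !mulgA.
have conjE (u v w : G) : u ^ v = w -> u * v = v * w by move=> <-; exact: conjgC.
split.
  (* [rope_eqs] has 24 members: fourteen commutations and ten conjugation rules. *)
  do 24 (case/andP; move=> /eqP ?); move=> _.
  by split; split=> //; apply: conjg_intro; rewrite ?conjgE ?mulgA.
case=> [[? ? ? ?] [? ? ?] [? ? ?] [? ? ? ?] [/conjE + /conjE + /conjE +]
  [/conjE + /conjE + /conjE +] [/conjE + /conjE +] [/conjE + /conjE +]].
rewrite !conjgE !mulgA => *.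
by do 24 (apply/andP; split; first by apply/eqP).
Qed.

Lemma word_eval_relator (I : choiceType) (G : groupType) (g : I -> G) (u v : word I) :
  word_eval g (u ++ inv_word v) = 1 <-> word_eval g u = word_eval g v.
Proof.
rewrite word_eval_cat word_eval_inv; split=> [/divg1_eq //|->]; exact: mulgV.
Qed.

Lemma F3_gens (i : 'I_3) :
  [\/ pres_gen i = F3a, pres_gen i = F3b | pres_gen i = F3c].
Proof.
have -> : i = inord i by rewrite inord_val.
by case: i => [[|[|[|]]]] // ?; [constructor 1 | constructor 2 | constructor 3].
Qed.

Lemma F3_lift (G : groupType) (a b c : G) :
  exists phi : {multiplicative F3 -> G}, [/\ phi F3a = a, phi F3b = b & phi F3c = c].
Proof.
have [phi phiE] := free_group_lift (fun i : 'I_3 => nth 1 [:: a; b; c] i).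
by exists phi; rewrite !phiE !inordK.
Qed.

Lemma morph_a_fun (G : groupType) (chi : {multiplicative F3 -> G}) (x y : G) f :
  chi F3b = x -> x ^ chi F3c = y -> y ^ chi F3c = x ->
  chi (a_fun f) = chi F3a ^ word_eval (pair2 x y) (w_ f).
Proof.
by move=> bx xd yd; rewrite /a_fun group_morphJ (morph_b_fun _ bx xd yd).
Qed.

(** The case [x = y = 1] of [morph_a_fun]: the conjugating element is a word in trivial elements. *)
Lemma morph_a_fun_trivial (G : groupType) (chi : {multiplicative F3 -> G}) f :
  chi F3b = 1 -> chi F3c = 1 -> chi (a_fun f) = chi F3a.
Proof.
move=> b1 c1; rewrite (morph_a_fun f b1 (conj1g _) (conj1g _)).
rewrite (eq_word_eval (g' := fun=> 1)); last by move=> i; rewrite /pair2; case: ifP.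
elim: (w_ f) => [|l w IHw]; first by rewrite word_eval_nil conjg1.
by rewrite word_eval_cons /letter_eval invg1 if_same mul1g.
Qed.

(** Since [t] fixes [phi (a_fun f)], the two rules for conjugation by [s] apply to the same element,
    so the multipliers [chi (a_fun f)] and [chi2 (a_fun f)] coincide. This makes [al] commute with
    the word in [x], [y], and conjugating that word by [al] then exhibits the word in [x'], [y'] as
    a trivial factor. *)
Lemma rope_kills (G : groupType) (a b c t s al x y d x' y' : G)
    (phi : {multiplicative F3 -> G}) f :
  rope a b c t s al x y d x' y' ->
  phi F3a = a -> phi F3b = b -> phi F3c = c -> commute t (phi (a_fun f)) ->
  word_eval (pair2 x' y') (w_ f) = 1.
Proof.
case=> -[al_a al_b al_c al_t] [x_a x_b x_c] [d_a d_b d_c] [xx' xy' yx' yy'].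
move=> [as_ bs cs] [ats bts cts] [xd yd] [xal yal] phia phib phic comm_t.
have [chi [chia chib chic]] := F3_lift al x d.
have [chi2 [chi2a chi2b chi2c]] := F3_lift al 1 1.
(* The first conjugator is trivial here, as [s] acts on [a], [b], [c] themselves. *)
have E1 z : (phi z ^ 1) ^ s = phi z ^ 1 * chi z.
  apply: (@conj_pres_morph _ set0 G phi chi 1 s) => [i j|i]; rewrite conjg1.
    by case: (F3_gens i) => ->; case: (F3_gens j) => ->;
      rewrite ?(phia, phib, phic) ?(chia, chib, chic); exact: commute_sym.
  by case: (F3_gens i) => ->; rewrite ?(phia, phib, phic) ?(chia, chib, chic).
(* [al] commutes with [t], hence with the [t]-conjugate of whatever it commutes with. *)
have al_conj u : commute al u -> commute (u ^ t) al.
  move=> alu; apply: commute_sym; rewrite conjgE.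
  by apply: commuteM; [exact: commuteV | exact: commuteM].
have E2 z : (phi z ^ t) ^ s = phi z ^ t * chi2 z.
  apply: (@conj_pres_morph _ set0 G phi chi2 t s) => [i j|i].
    by case: (F3_gens i) => ->; case: (F3_gens j) => ->;
      rewrite ?(phia, phib, phic) ?(chi2a, chi2b, chi2c);
      first [exact: al_conj | exact: commute1].
  by case: (F3_gens i) => ->;
    rewrite ?(phia, phib, phic) ?(chi2a, chi2b, chi2c) ?mulg1.
have fixt : phi (a_fun f) ^ t = phi (a_fun f) by rewrite conjgE -comm_t mulKg.
have := E2 (a_fun f); rewrite fixt -[in LHS](conjg1 (phi _)) E1 conjg1 => /mulgI.
have [xchi ychi] : x ^ chi F3c = y /\ y ^ chi F3c = x by rewrite chic.
rewrite (morph_a_fun f chib xchi ychi) (morph_a_fun_trivial f chi2b chi2c) chia chi2a.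
move=> alW.
(* The same device a third time, on the free group of rank two: [al] multiplies [x], [y] by [x'],
   [y']. *)
have [psi psiE] := free_group_lift (pair2 x y).
have [psi' psi'E] := free_group_lift (pair2 x' y').
have E3 z : (psi z ^ 1) ^ al = psi z ^ 1 * psi' z.
  by apply: (@conj_pres_morph _ set0 G psi psi' 1 al) => [i j|i];
    rewrite conjg1 !(psiE, psi'E) /pair2;
    do ?case: ifP.
have := E3 (word_class (w_ f)).
rewrite conjg1 word_class_eval !morph_word_eval.
rewrite (eq_word_eval _ psiE) (eq_word_eval _ psi'E).
set W := word_eval (pair2 x y) _ in alW *.
have -> : W ^ al = W.
  by rewrite conjgE -[in W * al]alW -conjgC mulKg.
by rewrite -[in LHS](mulg1 W) => /mulgI.
Qed.

(** * A model of the rope relations *)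

(** The inverse is part of the data, so the group operations need no choice; by [bijectionP]
    equality still depends on the map alone. *)
Record bijection (T : Type) := Bijection {
  bij_fun :> T -> T;
  bij_inv : T -> T;
  bijK : cancel bij_fun bij_inv;
  bij_invK : cancel bij_inv bij_fun
}.

Section BijectionGroup.
Variable T : Type.
Implicit Types f g : bijection T.

Lemma bijectionP f g : f =1 g -> f = g.
Proof.
case: f g => [f f' fK f'K] [g g' gK g'K] /= /funext fg; case: _ / fg in gK g'K *.
have fg' : f' = g' by apply/funext => x; rewrite -[in LHS](g'K x) fK.
case: _ / fg' in gK g'K *.
by congr Bijection; exact: Prop_irrelevance.
Qed.

HB.instance Definition _ := gen_eqMixin (bijection T).
HB.instance Definition _ := gen_choiceMixin (bijection T).

Definition bij_one : bijection T := 
  @Bijection T id id (fun=> erefl) (fun=> erefl).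
Definition bij_opp f : bijection T := Bijection (@bij_invK T f) (@bijK T f).
Definition bij_mul f g : bijection T :=
  Bijection (can_comp (@bijK T f) (@bijK T g))
            (can_comp (@bij_invK T g) (@bij_invK T f)).

Lemma bij_mulA : associative bij_mul.
Proof. by move=> f g h; apply: bijectionP. Qed.

Lemma bij_mul1 : left_id bij_one bij_mul.
Proof. by move=> f; apply: bijectionP. Qed.

Lemma bij_mulr1 : right_id bij_one bij_mul.
Proof. by move=> f; apply: bijectionP. Qed.

Lemma bij_mulV : left_inverse bij_one bij_opp bij_mul.
Proof. by move=> f; apply: bijectionP => x; exact: bijK. Qed.

Lemma bij_mulrV : right_inverse bij_one bij_opp bij_mul.
Proof. by move=> f; apply: bijectionP => x; exact: bij_invK. Qed.

HB.instance Definition _ := isGroup.Build (bijection T)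
  bij_mulA bij_mul1 bij_mulr1 bij_mulV bij_mulrV.

Lemma bij_mulE f g x : (f * g) x = f (g x). Proof. by []. Qed.

Lemma bij_VK f x : f^-1 (f x) = x. Proof. exact: bijK. Qed.

Lemma bij_KV f x : f (f^-1 x) = x. Proof. exact: bij_invK. Qed.

(* Cantor-Bernstein for two self-injections, carried out so that the bijection
   inherits the symmetries common to both. *)
Lemma equivariant_bernstein (i j : T -> T) : injective i -> injective j ->
  exists t : bijection T,
    (forall x, t x = i x \/ j (t x) = x) /\
    (forall f, (forall x, i (f x) = f (i x)) -> (forall x, j (f x) = f (j x)) ->
       commute t f).
Proof.
move=> i_inj j_inj.
pose ji x := j (i x).
(* As in the usual proof, [C] consists of the points reached by [j \o i] from outside the image of
   [j]; the bijection is [i] on [C] and the inverse of [j] elsewhere. *)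
pose C x := exists n x0, x = iter n ji x0 /\ ~ exists u, j u = x0.
have pre (k : T -> T) : exists k', forall y, (exists u, k u = y) -> k (k' y) = y.
  have [//|k' k'P] := @choice T T (fun y u => (exists v, k v = y) -> k u = y).
    move=> y; have [[u ku]|nku] := pselect (exists u, k u = y); first by exists u.
    by exists y.
  by exists k'.
have [[i' i'P] [j' j'P]] := (pre i, pre j).
have nC_im x : ~ C x -> j (j' x) = x.
  move=> nCx; apply: j'P; apply: contrapT => nj.
  by apply: nCx; exists 0%N, x.
have C_ji x : C x -> C (ji x) by move=> [n [x0 [-> nj]]]; exists n.+1, x0.
have C_j x : C (j x) -> exists2 y, C y & x = i y.
  move=> [[|n] [x0 [jx nj]]]; first by case: nj; exists x.
  by exists (iter n ji x0); [exists n, x0 | exact: j_inj].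
have iK y : i' (i y) = y by apply: i_inj; apply: i'P; exists y.
have jK y : j' (j y) = y by apply: j_inj; apply: j'P; exists y.
pose t x := if `[< C x >] then i x else j' x.
(* [j x] lies in [C] exactly when [x] is the image under [i] of a point of [C], so this test
   recovers the branch taken by [t]. *)
pose t' x := if `[< C (j x) >] then i' x else j x.
have tK : cancel t t'.
  rewrite /t /t' => x; case: (asboolP (C x)) => [Cx|nCx] /=.
    by case: asboolP => [_|[]] /=; [exact: iK | exact: C_ji].
  by rewrite nC_im //; case: asboolP.
have t'K : cancel t' t.
  rewrite /t /t' => x; case: (asboolP (C (j x))) => [/C_j[y Cy ->]|nCx] /=.
    by rewrite iK; case: asboolP.
  by case: asboolP.
exists (Bijection tK t'K); split=> [x|f fi fj] /=.
  by rewrite /t; case: asboolP => [|nCx] /=; [left | right; exact: nC_im].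
(* Applied to [f] and to its inverse, this shows that [f] preserves both [C] and its complement. *)
have C_f (g : bijection T) : (forall x, ji (g x) = g (ji x)) ->
    (forall x, j (g^-1 x) = g^-1 (j x)) -> forall x, C x -> C (g x).
  move=> gji gj x [n [x0 [-> nj]]]; exists n, (g x0); split.
    by elim: n => //= n <-; rewrite gji.
  by move=> [u ju]; apply: nj; exists (g^-1 u); rewrite gj ju bij_VK.
have fjV x : j (f^-1 x) = f^-1 (j x) by rewrite -[in RHS](bij_KV f x) fj bij_VK.
have fiV x : i (f^-1 x) = f^-1 (i x) by rewrite -[in RHS](bij_KV f x) fi bij_VK.
apply: bijectionP => x; rewrite !bij_mulE /= /t.
case: asboolP => [Cfx|nCfx] /=; case: asboolP => [Cx|nCx] //=.
- case: nCx; rewrite -(bij_VK f x); apply: C_f Cfx => y; rewrite ?invgK //.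
  by rewrite /ji fiV fjV.
- by case: nCfx; apply: C_f Cx => y //; rewrite /ji fi fj.
- by apply: j_inj; rewrite fj !nC_im.
Qed.

End BijectionGroup.

Section ProductBijections.
Variables (S Z : Type).

Definition bij_fst (f : bijection S) : bijection (S * Z).
Proof.
refine (@Bijection _ (fun p => (f p.1, p.2)) (fun p => (bij_inv f p.1, p.2)) _ _) => -[x z] /=.
- by rewrite bijK.
- by rewrite bij_invK.
Defined.

(** Conjugation by such a map turns the equivariance of [h] into multiplication by constants on the
    second factor; the letter [s] will act in this way. *)
Definition bij_twist (h : S -> bijection Z) : bijection (S * Z).
Proof.
refine (@Bijection _ (fun p => (p.1, h p.1 p.2)) (fun p => (p.1, bij_inv (h p.1) p.2)) _ _)
  => -[x z] /=.
- by rewrite bijK.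
- by rewrite bij_invK.
Defined.

Lemma bij_fstM : {morph bij_fst : f g / f * g}.
Proof. by move=> f g; apply: bijectionP. Qed.

HB.instance Definition _ := isMultiplicative.Build _ _ bij_fst bij_fstM.

Definition bij_snd (f : bijection Z) := bij_twist (fun=> f).

Lemma bij_sndM : {morph bij_snd : f g / f * g}.
Proof. by move=> f g; apply: bijectionP. Qed.

HB.instance Definition _ := isMultiplicative.Build _ _ bij_snd bij_sndM.

Lemma commute_snd_fst f g : commute (bij_snd g) (bij_fst f).
Proof. by apply: bijectionP. Qed.

End ProductBijections.

(** * Equivariant maps and the space on which [K] and [t] act *)

Lemma coset_transversal (K : groupType) (H N : set K) : is_subgroup H ->
  exists rho : K -> K,
    [/\ forall k, H (k * (rho k)^-1), forall h k, H h -> rho (h * k) = rho k &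
        forall k, N k -> N (rho k)].
Proof.
(* Choice is made on cosets as sets, so [rho] depends only on the coset; a representative in [N] is
   preferred whenever the coset meets [N]. *)
move=> sgH; pose C k : set K := [set r | H (k * r^-1)].
have [rho rhoP] : {rho : set K -> K & forall S : set K,
    (S !=set0 -> S (rho S)) /\ (S `&` N !=set0 -> N (rho S))}.
  apply: (@choice _ _ (fun (S : set K) r => (S !=set0 -> S r) /\ (S `&` N !=set0 -> N r))).
  move=> S; have [[r [Sr Nr]]|SN] := pselect (S `&` N !=set0); first by exists r.
  have [[r Sr]|S0] := pselect (S !=set0); first by exists r.
  by exists 1.
have Ck k : C k k by rewrite /C /= mulgV; case: sgH.
have CM h k : H h -> C (h * k) = C k.
  move=> Hh; apply/seteqP; split=> r; rewrite /C /= => Hr.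
    by have := is_subgroupM sgH (is_subgroupV sgH Hh) Hr; rewrite -mulgA mulKg.
  by rewrite -mulgA; exact: is_subgroupM.
exists (rho \o C); split=> [k|h k Hh|k Nk] /=.
- by apply: (rhoP (C k)).1; exists k.
- by rewrite CM.
- by apply: (rhoP (C k)).2; exists k.
Qed.

Section RopeSpace.
Variables (F K M : groupType) (phi : {multiplicative F -> K}) (L : set K).
Variable psi : bool -> {multiplicative F -> M}.
Hypotheses (phi_inj : injective phi) (sgL : is_subgroup L).
Hypothesis psi_agree : forall g, L (phi g) -> psi true g = psi false g.

Definition equivariant b (eta : K -> M) :=
  forall g k, eta (phi g * k) = psi b g * eta k.

(** Injectivity of [phi] makes [F] act freely on [K], so an equivariant map may take arbitrary
    values on a transversal of the cosets of [range phi]. Representatives lie in [N] wherever a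
    coset meets [N], which yields agreement with [f] there. *)
Lemma equivariant_extension b (N : set K) (f : K -> M) : is_subgroup N ->
  (forall g k, N (phi g) -> N k -> f (phi g * k) = psi b g * f k) ->
  exists2 eta, equivariant b eta & forall k, N k -> eta k = f k.
Proof.
move=> sgN fN.
have sgF : is_subgroup (range phi).
  split=> [|_ _ [g _ <-] [h _ <-]]; first by exists 1; rewrite // group_morph1.
  by exists (g * h^-1); rewrite // gmulfM group_morphV.
have [rho [rhoF rhoM rhoN]] := coset_transversal N sgF.
have [gam gamE] : {gam : K -> F & forall k, phi (gam k) = k * (rho k)^-1}.
  apply: (@choice K F (fun k g => phi g = k * (rho k)^-1)) => k.
  by have [g _ gE] := rhoF k; exists g.
exists (fun k => psi b (gam k) * f (rho k)) => [g k|k Nk].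
  have -> : gam (phi g * k) = g * gam k.
    by apply: phi_inj; rewrite gmulfM !gamE rhoM ?mulgA //; exists g.
  by rewrite rhoM ?gmulfM ?mulgA //; exists g.
rewrite -fN ?gamE ?mulgVK //; last exact: rhoN.
by apply: is_subgroupM => //; apply: is_subgroupV => //; exact: rhoN.
Qed.

(** [psi true] is the effect of [s] on [phi g] and [psi false] its effect on the conjugate of
    [phi g] by [t]; a point carries one equivariant map for each. *)
Definition equivariant_pair := {eta : bool -> K -> M | forall b, equivariant b (eta b)}.

(* The list records the arguments of the injections of Cantor-Bernstein. *)
Definition rope_space : Type := (K * equivariant_pair * seq (K * equivariant_pair))%type.

Definition rope_val b (w : rope_space) : M := sval w.1.2 b w.1.1.

Definition rope_trans (k : K) : bijection rope_space.
Proof.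
refine (@Bijection _ (fun w => (k * w.1.1, w.1.2, w.2))
                     (fun w => (k^-1 * w.1.1, w.1.2, w.2)) _ _) => -[[k0 eta] c] /=.
- by rewrite mulKg.
- by rewrite mulVKg.
Defined.

Lemma rope_transM : {morph rope_trans : k l / k * l}.
Proof. by move=> k l; apply: bijectionP => w /=; rewrite mulgA. Qed.

HB.instance Definition _ := isMultiplicative.Build _ _ rope_trans rope_transM.

Lemma rope_val_trans b g w : rope_val b (rope_trans (phi g) w) = psi b g * rope_val b w.
Proof. by case: w => -[k eta] c; exact: (svalP eta). Qed.

Lemma psi_agree_neg b g : L (phi g) -> psi (~~ b) g = psi b g.
Proof. by move=> /psi_agree; case: b. Qed.

(** Write [k = l * r] with [l] in [L] and [r] the representative of the coset of [k]. The point
    moves to [l], and its maps are replaced by a pair whose map of index [~~ b] extends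
    [fun l => sval e b (l * r)] from [L]. Left multiplication by [L] keeps [r], which gives
    equivariance; recording [r] and the old maps gives injectivity. *)
Lemma rope_shift b : exists i : rope_space -> rope_space,
  [/\ injective i, forall w, rope_val (~~ b) (i w) = rope_val b w &
      forall l, L l -> forall w, i (rope_trans l w) = rope_trans l (i w)].
Proof.
have [rho [rhoL rhoM _]] := coset_transversal setT sgL.
have [ext extP] : {ext : K * equivariant_pair -> equivariant_pair &
    forall p k, L k -> sval (ext p) (~~ b) k = sval p.2 b (k * p.1)}.
  apply: (@choice _ _ (fun p (e : equivariant_pair) =>
            forall k, L k -> sval e (~~ b) k = sval p.2 b (k * p.1))) => -[r e] /=.
  (* On elements that [phi] sends into [L] the two morphisms agree, so a [b]-equivariant function
     restricted to [L] extends to a [~~ b]-equivariant one. *)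
  have [g k Lg _|eta eta_eqv etaE] :=
    @equivariant_extension (~~ b) L (fun k => sval e b (k * r)) sgL.
    by rewrite -mulgA (svalP e b) psi_agree_neg.
  pose eta' b' := if b' == ~~ b then eta else sval e b'.
  have eta'P b' : equivariant b' (eta' b').
    by rewrite /eta'; case: eqP => [->//|_]; exact: (svalP e).
  by exists (exist _ eta' eta'P) => k Lk /=; rewrite /eta' eqxx etaE.
exists (fun w => (w.1.1 * (rho w.1.1)^-1, ext (rho w.1.1, w.1.2),
                 (rho w.1.1, w.1.2) :: w.2)).
split=> [[[k e] c] [[k' e'] c'] /= [kk' _ rr' -> ->]|[[k e] c]|l Ll [[k e] c]] /=.
- by move: kk'; rewrite rr' => /mulIg ->.
- by rewrite /rope_val /= extP //= mulgVK.
- by rewrite /rope_trans /= rhoM // mulgA.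
Qed.

(** The constant map 1 on the trivial subgroup extends equivariantly; a point is needed later to see
    that [T_ X] acts faithfully. *)
Lemma rope_space_inhabited : rope_space.
Proof.
suff [eta etaP] : {eta : bool -> K -> M & forall b, equivariant b (eta b)}.
  by exact: (1, exist _ eta etaP, [::]).
apply: (@choice bool (K -> M) equivariant) => b.
have sg1 : is_subgroup [set (1 : K)].
  by split=> // x y -> -> /=; rewrite invg1 mulg1.
have [g k g1 _|eta etaP _] := @equivariant_extension b _ (fun=> 1) sg1; last by exists eta.
have -> : g = 1 by apply: phi_inj; rewrite group_morph1.
by rewrite group_morph1 mulg1.
Qed.

Lemma rope_exists : exists (S : Type) (kap : {multiplicative K -> bijection S})
    (t : bijection S) (h : S -> M) (_ : S),
  [/\ forall l, L l -> commute t (kap l),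
      forall g w, h (kap (phi g) w) = psi true g * h w &
      forall g w, h ((kap (phi g) ^ t) w) = psi false g * h w].
Proof.
have [i [i_inj ival iL]] := rope_shift true.
have [j [j_inj jval jL]] := rope_shift false.
have [t [tij tcomm]] := equivariant_bernstein i_inj j_inj.
(* [i] turns the value of index [true] into that of index [false] and [j] does the converse, so both
   alternatives in [tij] give the same rule. *)
have tval w : rope_val false (t w) = rope_val true w.
  by case: (tij w) => [->|{2}<-]; rewrite ?(ival w) // (jval (t w)).
exists rope_space, rope_trans, t, (rope_val true), rope_space_inhabited.
split=> [l Ll|g w|g w].
- by apply: tcomm => w; [exact: iL | exact: jL].
- exact: rope_val_trans.
- by rewrite -tval conjgE !bij_mulE bij_KV rope_val_trans tval.
Qed.

End RopeSpace.

(** * Permutations of the cube of a group *)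

Section TripleBijections.
Variable T : groupType.
Implicit Types u v w : T.

Definition triple_mul u v w : bijection (T * T * T).
Proof.
refine (@Bijection _ (fun p => (u * p.1.1, v * p.1.2, w * p.2))
  (fun p => (u^-1 * p.1.1, v^-1 * p.1.2, w^-1 * p.2)) _ _) => -[[p q] r] /=.
- by rewrite !mulKg.
- by rewrite !mulVKg.
Defined.

Definition triple_swap : bijection (T * T * T).
Proof.
by refine (@Bijection _ (fun p => (p.1.2, p.1.1, p.2))
  (fun p => (p.1.2, p.1.1, p.2)) _ _) => -[[p q] r].
Defined.

(** With this inverse, conjugating [triple_mul u v 1] gives the third coordinate
    [(u p) p^-1 r = u r], a constant multiple of [r]. *)
Definition triple_shear : bijection (T * T * T).
Proof.
refine (@Bijection _ (fun p => (p.1, p.1.1^-1 * p.2))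
  (fun p => (p.1, p.1.1 * p.2)) _ _) => -[[p q] r] /=.
- by rewrite mulVKg.
- by rewrite mulKg.
Defined.

Lemma triple_mulM u v w u' v' w' :
  triple_mul u v w * triple_mul u' v' w' = triple_mul (u * u') (v * v') (w * w').
Proof. by apply: bijectionP => p /=; rewrite !mulgA. Qed.

Lemma triple_mulV u v w : (triple_mul u v w)^-1 = triple_mul u^-1 v^-1 w^-1.
Proof. exact: bijectionP. Qed.

Lemma triple_mul1 : triple_mul 1 1 1 = 1.
Proof. by apply: bijectionP => -[[p q] r] /=; rewrite !mul1g. Qed.

Lemma word_eval_triple (I : choiceType) (g h : I -> T) (s : word I) :
  word_eval (fun i => triple_mul (g i) (h i) 1) s =
  triple_mul (word_eval g s) (word_eval h s) 1.
Proof.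
elim: s => [|[i b] s IHs]; first by rewrite !word_eval_nil triple_mul1.
rewrite !word_eval_cons IHs /letter_eval.
by case: b; rewrite ?triple_mulV triple_mulM ?invg1 mulg1.
Qed.

Lemma triple_swap_conj u v w : triple_mul u v w ^ triple_swap = triple_mul v u w.
Proof. by apply: conjg_intro; apply: bijectionP. Qed.

Lemma triple_shear_conj u v :
  triple_mul u v 1 ^ triple_shear = triple_mul u v 1 * triple_mul 1 1 u.
Proof.
apply: conjg_intro; apply: bijectionP => -[[p q] r] /=.
by rewrite !mul1g invgM -mulgA mulKg.
Qed.

Lemma triple_comm3 u v w : commute (triple_mul u v 1) (triple_mul 1 1 w).
Proof. by rewrite /commute !triple_mulM !mul1g !mulg1. Qed.

Lemma triple_mul3_morph : {morph triple_mul 1 1 : u v / u * v}.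
Proof. by move=> u v; rewrite triple_mulM !mulg1. Qed.

HB.instance Definition _ := isMultiplicative.Build _ _ (triple_mul 1 1) triple_mul3_morph.

End TripleBijections.

(** The multipliers prescribed for [s] are the values of [psi1] and [psi2] among the permutations of
    [T^3]. The relators of [T_ X] are used to make both agree on the preimage of [L], as
    [rope_exists] demands. *)
Lemma rope_model (X : set E) (K : groupType) (phi : {multiplicative F3 -> K})
    (L : set K) :
  injective phi -> is_subgroup L -> phi @` A_ X = range phi `&` L ->
  exists (M : groupType) (kap : {multiplicative K -> M})
      (theta : {multiplicative T_ X -> M}) (t s al x y d : M),
    [/\ injective theta, forall l, L l -> commute t (kap l) &
        rope (kap (phi F3a)) (kap (phi F3b)) (kap (phi F3c)) t s al x y d
          (theta (pres_gen ord0)) (theta (pres_gen ord_max))].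
Proof.
move=> phi_inj sgL AL; pose T := T_ X.
pose xT : T := pres_gen ord0; pose yT : T := pres_gen ord_max.
pose al := triple_shear T; pose d := triple_swap T.
(* [w_f (x, y)] acts as [w_f] on the first factor, hence trivially when f is in
   X, and therefore commutes with the shear [al]. *)
pose x := triple_mul xT yT 1; pose y := triple_mul yT xT 1.
have xd : x ^ d = y by exact: triple_swap_conj.
have yd : y ^ d = x by exact: triple_swap_conj.
have [psi1 [psi1a psi1b psi1c]] := F3_lift al x d.
have [psi2 [psi2a psi2b psi2c]] := F3_lift al 1 1.
pose psi b := if b then psi1 else psi2.
have wX f : X f -> word_eval (pair2 xT yT) (w_ f) = 1.
  move=> Xf; rewrite -(@relator_eval _ (w_ @` X) (w_ f)); last by exists f.
  apply: eq_word_eval => i; rewrite /pair2; case: eqP => [->//|/eqP i0].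
  by congr pres_gen; apply/val_inj; case: i i0 => [[|[|]]].
have agree g : L (phi g) -> psi true g = psi false g.
  (* Elements sent into [L] lie in [A_ X] by [AL], and agreement on [A_ X] may be checked on the
     generators [a_fun f]. *)
  move=> Lg; have [g' Ag' /phi_inj gE] : (phi @` A_ X) (phi g).
    by rewrite AL; split=> //; exists g.
  rewrite -{}gE; move: g' Ag' {g Lg}.
  apply: (subgroup_gen_min (equalizer_subgroup psi1 psi2)) => _ [f Xf <-] /=.
  have [xE yE] : x ^ psi1 F3c = y /\ y ^ psi1 F3c = x by rewrite psi1c.
  rewrite (morph_a_fun f psi1b xE yE) (morph_a_fun_trivial f psi2b psi2c) psi1a psi2a.
  (* The second coordinate, with the letters interchanged, may be nontrivial, but the shear reads
     only the first coordinate and changes only the third. *)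
  have -> : word_eval (pair2 x y) (w_ f) =
      triple_mul 1 (word_eval (pair2 yT xT) (w_ f)) 1.
    rewrite -[X in triple_mul X _ _](wX f Xf) -word_eval_triple.
    by apply: eq_word_eval => i; rewrite /pair2; case: ifP.
  apply: conjg_intro; apply: bijectionP => -[[p q] r] /=.
  by rewrite !mul1g.
have [S [kap [t [h [s0 [tL h1 h2]]]]]] := @rope_exists _ _ _ phi L psi phi_inj sgL agree.
pose Z : Type := (T * T * T)%type.
pose fstS : {multiplicative bijection S -> bijection (S * Z)} := @bij_fst S Z.
pose sndS : {multiplicative bijection Z -> bijection (S * Z)} := @bij_snd S Z.
exists (bijection (S * Z)), (fstS \o kap), (sndS \o triple_mul 1 1).
exists (fstS t), (bij_twist h)^-1, (sndS al), (sndS x), (sndS y), (sndS d).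
(* The conjugate of [u] by the inverse twist maps [(w, z)] to
   [(u w, h (u w) (h w)^-1 z) = (u w, m z)]; hence the inverse in the choice of [s]. *)
have twist (u : bijection S) m : (forall w, h (u w) = m * h w) ->
    fstS u ^ (bij_twist h)^-1 = fstS u * sndS m.
  move=> hu; apply: conjg_intro; apply: (@mulgI _ (bij_twist h)).
  apply: (@mulIg _ (bij_twist h)); rewrite -!mulgA mulVg mulg1 mulVKg.
  by apply: bijectionP => -[w z] /=; rewrite hu.
have sndJ u v : sndS u ^ sndS v = sndS (u ^ v) by rewrite group_morphJ.
have fstJ u v : fstS u ^ fstS v = fstS (u ^ v) by rewrite group_morphJ.
split.
(* An element acts by left translation on the third coordinate and is read off from the image of
   [(s0, (1, 1, 1))]. *)
- move=> u v /= uv; have := congr1 (fun b : bijection _ => (b (s0, (1, 1, 1))).2.2) uv.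
  by rewrite /= !mulg1.
- by move=> l /tL tl; rewrite /= /commute -!(bij_fstM _ _ _) tl.
have comm u v : commute (sndS u) (fstS v) by exact: commute_snd_fst.
have twist1 g : fstS (kap (phi g)) ^ (bij_twist h)^-1 = fstS (kap (phi g)) * sndS (psi1 g).
  exact: twist (h1 g).
have twist2 g : (fstS (kap (phi g)) ^ fstS t) ^ (bij_twist h)^-1 =
    fstS (kap (phi g)) ^ fstS t * sndS (psi2 g).
  by rewrite fstJ; exact: twist (h2 g).
have commZ u v w : commute (sndS (triple_mul u v 1)) (sndS (triple_mul 1 1 w)).
  by apply: gmulf_commute; exact: triple_comm3.
have shear u v :
    sndS (triple_mul u v 1) ^ sndS al = sndS (triple_mul u v 1) * sndS (triple_mul 1 1 u).
  by rewrite sndJ triple_shear_conj gmulfM.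
split; split; try exact: comm; try exact: commZ; try exact: shear.
- by have := twist1 F3a; rewrite psi1a.
- by have := twist1 F3b; rewrite psi1b.
- by have := twist1 F3c; rewrite psi1c.
- by have := twist2 F3a; rewrite psi2a.
- by have := twist2 F3b; rewrite psi2b group_morph1 mulg1.
- by have := twist2 F3c; rewrite psi2c group_morph1 mulg1.
- by rewrite sndJ xd.
- by rewrite sndJ yd.
Qed.

(** * Recursive functions of coded lists *)

Section MuRecursive.
Local Open Scope nat_scope.

(** Only lists of length [k] are constrained: argument lists are rebuilt from projections, which
    requires a known length. *)
Definition murec k (F : seq nat -> nat) :=
  exists e, forall v, size v = k -> mu_eval e v (F v).

Lemma eq_murec k F G : (forall v, size v = k -> F v = G v) -> murec k F -> murec k G.
Proof. by move=> FG [e eP]; exists e => v vk; rewrite -FG //; exact: eP. Qed.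

Lemma murec_comp k (Gs : seq (seq nat -> nat)) F :
  List.Forall (murec k) Gs -> murec (size Gs) F ->
  murec k (fun v => F [seq G v | G <- Gs]).
Proof.
move=> GsP [e eP].
have [es esP] : exists es, forall v, size v = k -> mu_evals es v [seq G v | G <- Gs].
  elim: GsP {eP} => [|G {}Gs [g gP] _ [es esP]]; first by exists [::] => v _; exact: mu_evals_nil.
  by exists (g :: es) => v vk; apply: mu_evals_cons; [exact: gP | exact: esP].
exists (MuComp e es) => v vk; apply: mu_eval_comp (esP v vk) _.
by apply: eP; rewrite size_map.
Qed.

Lemma murec_nth k i : murec k (fun v => nth 0 v i).
Proof. by exists (MuProj i) => v _; exact: mu_eval_proj. Qed.

Lemma murec_nth_drop k m i : murec k (fun v => nth 0 (drop m v) i).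
Proof.
by apply: eq_murec (murec_nth k (m + i)) => v _; rewrite nth_drop.
Qed.

Lemma murec1 k f G :
  murec 1 (fun v => f (nth 0 v 0)) -> murec k G -> murec k (fun v => f (G v)).
Proof.
by move=> fP GP; apply: (@murec_comp k [:: G] (fun v => f (nth 0 v 0))); repeat constructor.
Qed.

Lemma murec2 k f G1 G2 : murec 2 (fun v => f (nth 0 v 0) (nth 0 v 1)) ->
  murec k G1 -> murec k G2 -> murec k (fun v => f (G1 v) (G2 v)).
Proof.
by move=> fP GP1 GP2;
  apply: (@murec_comp k [:: G1; G2] (fun v => f (nth 0 v 0) (nth 0 v 1))); repeat constructor.
Qed.

Lemma murec3 k f G1 G2 G3 :
  murec 3 (fun v => f (nth 0 v 0) (nth 0 v 1) (nth 0 v 2)) ->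
  murec k G1 -> murec k G2 -> murec k G3 -> murec k (fun v => f (G1 v) (G2 v) (G3 v)).
Proof.
by move=> fP GP1 GP2 GP3; apply: (@murec_comp k [:: G1; G2; G3]
  (fun v => f (nth 0 v 0) (nth 0 v 1) (nth 0 v 2))); repeat constructor.
Qed.

Lemma murec_succ : murec 1 (fun v => (nth 0 v 0).+1).
Proof. by exists MuSucc => v _; exact: mu_eval_succ. Qed.

Lemma murec_const k c : murec k (fun=> c).
Proof.
elim: c => [|c IHc]; first by exists MuZero => v _; exact: mu_eval_zero.
exact: murec1 murec_succ IHc.
Qed.

(** The [k] arguments after the first [m]; composing with them passes parameters unchanged to an
    inner function. *)
Let projections k m := [seq (fun v => nth 0 v (m + i)) | i <- iota 0 k].

Let projectionsE k m v : size v = m + k -> [seq G v | G <- projections k m] = drop m v.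
Proof.
move=> vk; rewrite -map_comp; apply: (@eq_from_nth _ 0).
  by rewrite size_map size_iota size_drop vk addKn.
move=> i; rewrite size_map size_iota => ik.
by rewrite (nth_map 0) ?size_iota // nth_iota //= nth_drop.
Qed.

Let projectionsP k l m : List.Forall (murec l) (projections k m).
Proof.
rewrite /projections; elim: (iota 0 k) => [|i s IHs] /=; constructor => //.
exact: murec_nth.
Qed.

Let size_projections k m : size (projections k m) = k.
Proof. by rewrite size_map size_iota. Qed.

Lemma murec_weaken k m F : murec k F -> murec (m + k) (fun v => F (drop m v)).
Proof.
move=> FP; have := @murec_comp (m + k) (projections k m) F.
rewrite size_projections => /(_ (projectionsP k _ m) FP).
by apply: eq_murec => v vk; rewrite projectionsE.
Qed.

(** Replaces the counter and the accumulator of a step function while the parameters behind them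
    stay in place, as [murec_fold] requires. *)
Lemma murec_subst2 k (f : seq nat -> nat -> nat -> nat) X Y :
  murec k.+2 (fun w => f (drop 2 w) (nth 0 w 0) (nth 0 w 1)) ->
  murec k.+2 X -> murec k.+2 Y -> murec k.+2 (fun w => f (drop 2 w) (X w) (Y w)).
Proof.
move=> fP XP YP; have := @murec_comp k.+2 [:: X, Y & projections k 2]
  (fun w => f (drop 2 w) (nth 0 w 0) (nth 0 w 1)).
rewrite /= size_projections.
move=> /(_ (List.Forall_cons _ XP (List.Forall_cons _ YP (projectionsP k _ 2))) fP).
by apply: eq_murec => v vk; rewrite projectionsE // drop0.
Qed.

Fixpoint natrec (n b : nat) (s : nat -> nat -> nat) : nat :=
  if n is n'.+1 then s n' (natrec n' b s) else b.

(** [MuPrec] hands its step the counter, the previous value and then the parameters, hence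
    [drop 2]. *)
Lemma murec_natrec k N B (S : seq nat -> nat -> nat -> nat) :
  murec k N -> murec k B ->
  murec k.+2 (fun w => S (drop 2 w) (nth 0 w 0) (nth 0 w 1)) ->
  murec k (fun v => natrec (N v) (B v) (S v)).
Proof.
move=> NP [b bP] [s sP].
have recP : murec k.+1 (fun w => natrec (head 0 w) (B (behead w)) (S (behead w))).
  exists (MuPrec b s) => -[//|n v] [vk] /=.
  elim: n => [|n IHn] /=; first by apply: mu_eval_prec0; exact: bP.
  apply: mu_eval_precS IHn _.
  have := sP [:: n, natrec n (B v) (S v) & v]; rewrite /= drop0; apply.
  by rewrite vk.
have := @murec_comp k (N :: projections k 0)
  (fun w => natrec (head 0 w) (B (behead w)) (S (behead w))).
rewrite /= size_projections => /(_ (List.Forall_cons _ NP (projectionsP k k 0)) recP).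
by apply: eq_murec => v vk; rewrite projectionsE // drop0.
Qed.

Lemma murec_add : murec 2 (fun v => nth 0 v 0 + nth 0 v 1).
Proof.
apply: eq_murec (murec_natrec (S := fun _ _ z => z.+1) (murec_nth 2 0) (murec_nth 2 1) _).
  by move=> v _; elim: (nth 0 v 0) => //= n ->.
exact: murec1 murec_succ (murec_nth _ _).
Qed.

Lemma murec_mul : murec 2 (fun v => nth 0 v 0 * nth 0 v 1).
Proof.
apply: eq_murec
  (murec_natrec (S := fun v _ z => nth 0 v 1 + z) (murec_nth 2 0) (murec_const 2 0) _).
  by move=> v _; elim: (nth 0 v 0) => //= n ->.
exact: murec2 murec_add (murec_nth_drop _ _ _) (murec_nth _ _).
Qed.

Definition ifz (c a b : nat) := if c is 0 then a else b.

Lemma murec_ifz : murec 3 (fun v => ifz (nth 0 v 0) (nth 0 v 1) (nth 0 v 2)).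
Proof.
apply: eq_murec
  (murec_natrec (S := fun v _ _ => nth 0 v 2) (murec_nth 3 0) (murec_nth 3 1) _).
  by move=> v _; case: (nth 0 v 0).
exact: murec_nth_drop.
Qed.

Lemma murec_exp2 : murec 1 (fun v => 2 ^ nth 0 v 0).
Proof.
apply: eq_murec
  (murec_natrec (S := fun _ _ z => z + z) (murec_nth 1 0) (murec_const 1 1) _).
  by move=> v _; elim: (nth 0 v 0) => //= n ->; rewrite expnS mul2n addnn.
exact: murec2 murec_add (murec_nth _ _) (murec_nth _ _).
Qed.

Lemma murec_odd : murec 1 (fun v => odd (nth 0 v 0) : nat).
Proof.
apply: eq_murec
  (murec_natrec (S := fun _ _ z => ifz z 1 0) (murec_nth 1 0) (murec_const 1 0) _).
  by move=> v _; elim: (nth 0 v 0) => //= n ->; case: (odd n).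
exact: murec3 murec_ifz (murec_nth _ _) (murec_const _ _) (murec_const _ _).
Qed.

Lemma murec_half : murec 1 (fun v => (nth 0 v 0)./2).
Proof.
apply: eq_murec
  (murec_natrec (S := fun _ i z => odd i + z) (murec_nth 1 0) (murec_const 1 0) _).
  by move=> v _; elim: (nth 0 v 0) => //= n ->; rewrite uphalf_half.
apply: murec2 murec_add _ (murec_nth _ _).
exact: (murec1 (f := fun n => odd n : nat)) murec_odd (murec_nth _ _).
Qed.

Lemma natrec_iter n b f : natrec n b (fun=> f) = iter n f b.
Proof. by elim: n => //= n ->. Qed.

Lemma murec_iter f : murec 1 (fun v => f (nth 0 v 0)) ->
  murec 2 (fun v => iter (nth 0 v 0) f (nth 0 v 1)).
Proof.
move=> fP.
apply: eq_murec (murec_natrec (S := fun _ _ => f) (murec_nth 2 0) (murec_nth 2 1) _).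
  by move=> v _; rewrite natrec_iter.
exact: murec1 fP (murec_nth _ _).
Qed.

(** * Arithmetic on the codes of lists *)

Definition code_cons (x c : nat) := 2 ^ x * (c + c).+1.

Lemma code_consE x s : CodeSeq.code (x :: s) = code_cons x (CodeSeq.code s).
Proof. by rewrite /code_cons addnn. Qed.

Lemma murec_cons : murec 2 (fun v => code_cons (nth 0 v 0) (nth 0 v 1)).
Proof.
apply: murec2 murec_mul _ _; first exact: murec1 murec_exp2 (murec_nth _ _).
apply: murec1 murec_succ _.
exact: murec2 murec_add (murec_nth _ _) (murec_nth _ _).
Qed.

(* The head of a coded list is the 2-adic valuation of its code; as the code
   bounds the valuation, the search below is long enough. *)
Definition code_head c := natrec c 0 (fun _ h => ifz (odd (iter h half c)) h.+1 h).

(** Once the power of two is removed, the code of a nonempty list is odd, of the form [(c + c).+1],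
    and halving rounds it down to [c]. *)
Definition code_tail c := half (iter (code_head c) half c).

Lemma murec_head : murec 1 (fun v => code_head (nth 0 v 0)).
Proof.
apply: (@murec_natrec 1 (fun v => nth 0 v 0) (fun=> 0)
  (fun v _ h => ifz (odd (iter h half (nth 0 v 0))) h.+1 h)).
- exact: murec_nth.
- exact: murec_const.
apply: murec3 murec_ifz _ _ (murec_nth _ _).
  apply: (murec1 (f := fun n => odd n : nat)) murec_odd _.
  exact: (murec2 (f := fun i => iter i half)) (murec_iter murec_half)
    (murec_nth _ _) (murec_nth_drop _ _ _).
exact: murec1 murec_succ (murec_nth _ _).
Qed.

Lemma murec_tail : murec 1 (fun v => code_tail (nth 0 v 0)).
Proof.
apply: murec1 murec_half _.
exact: (murec2 (f := fun i => iter i half)) (murec_iter murec_half) murec_head (murec_nth _ _).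
Qed.

Lemma iter_half_cons x c i : i <= x -> iter i half (code_cons x c) = code_cons (x - i) c.
Proof.
elim: i => [|i IHi] ix /=; first by rewrite subn0.
rewrite IHi ?(ltnW ix) // /code_cons -(subnSK ix) expnS mul2n -doubleMl.
exact: doubleK.
Qed.

Lemma code_head_cons x c : code_head (code_cons x c) = x.
Proof.
rewrite /code_head; set n := code_cons x c.
(* The counter grows while the remaining quotient is even, that is until it reaches [x], and then
   stays. *)
have step m : natrec m 0 (fun _ h => ifz (odd (iter h half n)) h.+1 h) = minn m x.
  elim: m => [|m /= ->]; first by rewrite min0n.
  rewrite iter_half_cons ?geq_minr // /code_cons oddM oddX /= addnn odd_double andbT.
  have [mx|xm] := ltnP m x.
    by rewrite subn_eq0 leqNgt mx /= (minn_idPl mx).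
  by rewrite subnn /= (minn_idPr (leqW xm)).
rewrite step; apply/minn_idPr; rewrite /n /code_cons.
by apply: leq_trans (leq_pmulr _ _) => //; exact/ltnW/ltn_expl.
Qed.

Lemma code_tail_cons x c : code_tail (code_cons x c) = c.
Proof.
by rewrite /code_tail code_head_cons iter_half_cons // subnn /code_cons mul1n addnn /=
  uphalf_double.
Qed.

Lemma code_head_code s : code_head (CodeSeq.code s) = head 0 s.
Proof. by case: s => [//|x s]; rewrite code_consE code_head_cons. Qed.

Lemma code_tail_code s : code_tail (CodeSeq.code s) = CodeSeq.code (behead s).
Proof. by case: s => [//|x s]; rewrite code_consE code_tail_cons. Qed.

(** The code itself serves as the number of rounds, since it is at least the length of the list;
    surplus rounds meet the empty remainder, coded by 0, and keep the accumulator. *)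
Definition code_fold (c a : nat) (f : nat -> nat -> nat) :=
  natrec c a (fun i z => ifz (iter i code_tail c) z (f (code_head (iter i code_tail c)) z)).

Lemma code_fold_code s a f :
  code_fold (CodeSeq.code s) a f = foldl (fun z x => f x z) a s.
Proof.
rewrite /code_fold.
have tails i : iter i code_tail (CodeSeq.code s) = CodeSeq.code (drop i s).
  elim: i => [|i IHi] /=; first by rewrite drop0.
  by rewrite IHi code_tail_code -drop1 drop_drop add1n.
have step n : natrec n a (fun i z => ifz (iter i code_tail (CodeSeq.code s)) z
    (f (code_head (iter i code_tail (CodeSeq.code s))) z)) =
    foldl (fun z x => f x z) a (take n s).
  elim: n => [|n /= ->]; first by rewrite take0.
  rewrite tails code_head_code.
  have [ns|sn] := ltnP n (size s); last by rewrite drop_oversize //= !take_oversize // ltnW.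
  rewrite (drop_nth 0 ns) code_consE (take_nth 0 ns) -cats1 foldl_cat /=.
  (* The code of a nonempty list is positive, so [ifz] takes the branch that applies [f]. *)
  by rewrite /code_cons; case: (2 ^ _ * _) (muln_gt0 (2 ^ nth 0 s n) (CodeSeq.code (drop n.+1 s)
      + CodeSeq.code (drop n.+1 s)).+1); rewrite ?expn_gt0.
rewrite step take_oversize //.
(* It remains to bound the length of a list by its code. *)
elim: s {tails step} => [//|x s IHs]; rewrite code_consE /code_cons /=.
apply: leq_ltn_trans IHs _; apply: leq_trans (leq_pmull _ _); last by rewrite expn_gt0.
by rewrite ltnS leq_addr.
Qed.

Lemma murec_fold k C A (f : seq nat -> nat -> nat -> nat) :
  murec k C -> murec k A ->
  murec k.+2 (fun w => f (drop 2 w) (nth 0 w 0) (nth 0 w 1)) ->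
  murec k (fun v => code_fold (C v) (A v) (f v)).
Proof.
move=> CP AP fP; apply: murec_natrec => //.
have tlP : murec k.+2 (fun w => iter (nth 0 w 0) code_tail (C (drop 2 w))).
  exact: (murec2 (f := fun i => iter i code_tail)) (murec_iter murec_tail)
    (murec_nth _ _) (murec_weaken 2 CP).
apply: (murec3 murec_ifz tlP (murec_nth _ _)).
apply: murec_subst2 fP _ (murec_nth _ _).
exact: murec1 murec_head tlP.
Qed.

End MuRecursive.

(** * The presentation and its code *)

Section RopePresentation.
Variable n : nat.

(** The old generators come first and keep their indices, so an old word keeps its code. *)
Definition old_word (w : word 'I_n) : word 'I_(n + 11) :=
  [seq (lshift 11 l.1, l.2) | l <- w].

Definition new_word (w : word 'I_11) : word 'I_(n + 11) :=
  [seq (rshift n l.1, l.2) | l <- w].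

Definition rope_relators : seq (word 'I_11) :=
  [seq e.1 ++ inv_word e.2 | e <- rope_eqs].

(** The letters [a], [b], [c] become new generators identified with the given words by three
    relators, so that the rope relators are the same for all data. *)
Definition rope_base_relators (rels : seq (word 'I_n)) (emb : seq (word 'I_n)) :=
  [:: new_word [:: letterV 0] ++ old_word (nth [::] emb 0),
      new_word [:: letterV 1] ++ old_word (nth [::] emb 1),
      new_word [:: letterV 2] ++ old_word (nth [::] emb 2) &
      map new_word rope_relators ++ map old_word rels].

Definition rope_commutator (w : word 'I_n) : word 'I_(n + 11) :=
  new_word [:: letterV 3] ++ inv_word (old_word w) ++ new_word [:: letter 3] ++ old_word w.

End RopePresentation.

(** The left fold prepends the commutators in the order in which [code_fold] does so on codes. *)
Definition rope_pres (D : explicit_data) : fin_pres :=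
  let: existT n (rels, emb, sub) := D in
  existT (fun n => seq (word 'I_n)) (n + 11)%N
    (foldl (fun rs w => rope_commutator w :: rs) (rope_base_relators rels emb) sub).

(** * Computing the code of the presentation *)

Section RopePresentationCode.
Local Open Scope nat_scope.

Definition code_letter (n k b : nat) := code_cons (n + k) (code_cons b 0).

(** The word is a constant and only [n] and [c] vary, so each word gives a finite composition of
    [code_cons], without recursion on codes. *)
Definition code_new_word (n : nat) (w : seq (nat * bool)) (c : nat) :=
  foldr (fun l => code_cons (code_letter n l.1 (l.2 : bool))) c w.

Definition code_new_words (n : nat) (ws : seq (seq (nat * bool))) (c : nat) :=
  foldr (fun w => code_cons (code_new_word n w 0)) c ws.

Definition code_inv_letter (l : nat) :=
  code_cons (code_head l) (code_cons (ifz (code_head (code_tail l)) 1 0) 0).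

(** A left fold reverses by itself: pushing the inverted letters onto [d] one by one yields the
    inverse word followed by [d]. *)
Definition code_catinv (c d : nat) :=
  code_fold c d (fun l => code_cons (code_inv_letter l)).

Definition code_commutator (n c : nat) :=
  code_cons (code_letter n 3 1) (code_catinv c (code_cons (code_letter n 3 0) c)).

Definition word_vals (w : word 'I_11) : seq (nat * bool) := [seq (val l.1, l.2) | l <- w].

Definition code_base (n rels emb : nat) :=
  code_cons (code_cons (code_letter n 0 1) (code_head emb))
  (code_cons (code_cons (code_letter n 1 1) (code_head (code_tail emb)))
  (code_cons (code_cons (code_letter n 2 1) (code_head (code_tail (code_tail emb))))
  (code_new_words n [seq word_vals w | w <- rope_relators] rels))).

(** The heads and tails follow the nesting of [explicit_data], coded as [[n; [[rels; emb];
    sub]]]. *)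
Definition code_rope (D : nat) :=
  let n := code_head D in
  let body := code_head (code_tail D) in
  let rels := code_head (code_head body) in
  let emb := code_head (code_tail (code_head body)) in
  let sub := code_head (code_tail body) in
  code_cons (n + 11)
    (code_cons (code_fold sub (code_base n rels emb)
                  (fun w => code_cons (code_commutator n w))) 0).

Lemma pickle_letter m (i : 'I_m) (b : bool) :
  pickle (i, b) = code_cons i (code_cons b 0).
Proof. by rewrite -[0]/(CodeSeq.code [::]) -!code_consE. Qed.

Lemma pickle_cons (T : countType) (x : T) (s : seq T) :
  pickle (x :: s) = code_cons (pickle x) (pickle s).
Proof. exact: code_consE. Qed.

Lemma pickle_old_word n (w : word 'I_n) : pickle (old_word w) = pickle w.
Proof. by elim: w => [//|[i b] w IHw]; rewrite /= !pickle_cons IHw !pickle_letter. Qed.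

Lemma pickle_new_word n (w : word 'I_11) (s : word 'I_(n + 11)) :
  pickle (new_word n w ++ s) = code_new_word n (word_vals w) (pickle s).
Proof. by elim: w => [//|[i b] w IHw]; rewrite /= pickle_cons IHw pickle_letter. Qed.

Lemma pickle_new_words n (ws : seq (word 'I_11)) (s : seq (word 'I_(n + 11))) :
  pickle (map (new_word n) ws ++ s) =
  code_new_words n [seq word_vals w | w <- ws] (pickle s).
Proof.
elim: ws => [//|w ws IHw]; rewrite /= pickle_cons IHw -[new_word n w]cats0.
by rewrite pickle_new_word.
Qed.

Lemma code_inv_letterE m (l : 'I_m * bool) :
  code_inv_letter (pickle l) = pickle (inv_letter l).
Proof.
case: l => i b; rewrite /code_inv_letter !pickle_letter !(code_head_cons, code_tail_cons).
by case: b.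
Qed.

Lemma code_catinvE m (u v : word 'I_m) :
  code_catinv (pickle u) (pickle v) = pickle (inv_word u ++ v).
Proof.
rewrite /code_catinv code_fold_code /inv_word; elim: u v => [//|l u IHu] v /=.
by rewrite code_inv_letterE -pickle_cons IHu rev_cons cat_rcons.
Qed.

Lemma code_commutatorE n (w : word 'I_n) :
  code_commutator n (pickle w) = pickle (rope_commutator w).
Proof.
rewrite /rope_commutator pickle_new_word -code_catinvE pickle_new_word pickle_old_word.
by rewrite /= !inordK.
Qed.

Lemma code_baseE n (rels emb : seq (word 'I_n)) :
  code_base n (pickle rels) (pickle emb) = pickle (rope_base_relators rels emb).
Proof.
rewrite /code_base !(code_tail_code, code_head_code).
(* Past the end the defaults agree, as the empty word has code 0. *)
have embE i : nth 0 (map pickle emb) i = pickle (nth [::] emb i).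
  have [ie|ie] := ltnP i (size emb); first by rewrite (nth_map [::]).
  by rewrite !nth_default ?size_map.
rewrite -!nth0 !nth_behead !embE /rope_base_relators.
do 3 rewrite pickle_cons pickle_new_word pickle_old_word.
have relsE : pickle (map (@old_word n) rels) = pickle rels.
  by elim: rels => //= w rels IHr; rewrite !pickle_cons IHr pickle_old_word.
rewrite pickle_new_words relsE; set tail := code_new_words _ _ _.
by rewrite /= !inordK.
Qed.

Lemma code_ropeE D : code_rope (pickle D) = pickle (rope_pres D).
Proof.
case: D => n [[rels emb] sub].
have -> : pickle (existT _ n (rels, emb, sub) : explicit_data) =
  CodeSeq.code [:: n; CodeSeq.code [:: CodeSeq.code [:: pickle rels; pickle (tval emb)];
                                       pickle sub]] by [].
have -> rs : pickle (existT _ (n + 11) rs : fin_pres) =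
  code_cons (n + 11) (code_cons (pickle rs) 0) by rewrite -[0]/(CodeSeq.code [::]) -!code_consE.
rewrite /code_rope !(code_tail_code, code_head_code) /=.
rewrite code_baseE; congr (code_cons _ (code_cons _ _)).
rewrite [pickle sub]/(CodeSeq.code (map pickle sub)) code_fold_code.
move: (rope_base_relators _ _).
elim: sub => [//|w sub IHs] rs /=.
by rewrite code_commutatorE -pickle_cons IHs.
Qed.

Lemma murec_code_letter k G b m : murec k G -> murec k (fun v => code_letter (G v) m b).
Proof.
move=> GP; apply: (murec2 murec_cons) (murec_const _ _).
exact: (murec2 murec_add) GP (murec_const _ _).
Qed.

Lemma murec_code_new_word k G C w :
  murec k G -> murec k C -> murec k (fun v => code_new_word (G v) w (C v)).
Proof.
move=> GP CP; elim: w => [//|l w IHw] /=.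
exact: (murec2 murec_cons) (murec_code_letter _ _ GP) IHw.
Qed.

Lemma murec_code_new_words k G C ws :
  murec k G -> murec k C -> murec k (fun v => code_new_words (G v) ws (C v)).
Proof.
move=> GP CP; elim: ws => [//|w ws IHw] /=.
exact: (murec2 murec_cons) (murec_code_new_word _ GP (murec_const _ _)) IHw.
Qed.

Lemma murec_code_inv_letter : murec 1 (fun v => code_inv_letter (nth 0 v 0)).
Proof.
apply: (murec2 murec_cons); first exact: murec_head.
apply: (murec2 murec_cons) (murec_const _ _).
apply: (murec3 murec_ifz) (murec_const _ _) (murec_const _ _).
exact: (murec1 murec_head) murec_tail.
Qed.

Lemma murec_code_catinv : murec 2 (fun v => code_catinv (nth 0 v 0) (nth 0 v 1)).
Proof.
apply: (@murec_fold 2 _ _ (fun _ l => code_cons (code_inv_letter l))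
  (murec_nth _ _) (murec_nth _ _)).
exact: (murec2 murec_cons) (murec1 murec_code_inv_letter (murec_nth _ _)) (murec_nth _ _).
Qed.

Lemma murec_code_commutator : murec 2 (fun v => code_commutator (nth 0 v 0) (nth 0 v 1)).
Proof.
apply: (murec2 murec_cons); first exact: murec_code_letter (murec_nth _ _).
apply: (murec2 murec_code_catinv); first exact: murec_nth.
exact: (murec2 murec_cons) (murec_code_letter _ _ (murec_nth _ _)) (murec_nth _ _).
Qed.

Lemma murec_code_base :
  murec 3 (fun v => code_base (nth 0 v 0) (nth 0 v 1) (nth 0 v 2)).
Proof.
have letP m b : murec 3 (fun v => code_letter (nth 0 v 0) m b).
  exact: murec_code_letter (murec_nth _ _).
have tlP : murec 3 (fun v => code_tail (nth 0 v 2)).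
  exact: (murec1 murec_tail) (murec_nth _ _).
have hdP G : murec 3 G -> murec 3 (fun v => code_head (G v)).
  exact: (murec1 murec_head).
have consP m G : murec 3 G -> murec 3 (fun v => code_cons (code_letter (nth 0 v 0) m 1) (G v)).
  by apply: (murec2 murec_cons).
apply: (murec2 murec_cons); first exact: consP (hdP _ (murec_nth _ _)).
apply: (murec2 murec_cons); first exact: consP (hdP _ tlP).
apply: (murec2 murec_cons); first exact: consP (hdP _ ((murec1 murec_tail) tlP)).
exact: murec_code_new_words (murec_nth _ _) (murec_nth _ _).
Qed.

Lemma murec_code_rope : murec 1 (fun v => code_rope (nth 0 v 0)).
Proof.
have hdP k G : murec k G -> murec k (fun v => code_head (G v)).
  exact: (murec1 murec_head).
have tlP k G : murec k G -> murec k (fun v => code_tail (G v)).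
  exact: (murec1 murec_tail).
have nP k i : murec k (fun v => code_head (nth 0 v i)) by exact: hdP (murec_nth _ _).
have bodyP : murec 1 (fun v => code_head (code_tail (nth 0 v 0))).
  exact: hdP (tlP _ _ (murec_nth _ _)).
apply: (murec2 murec_cons); first exact: (murec2 murec_add) (nP _ _) (murec_const _ _).
apply: (murec2 murec_cons) (murec_const _ _).
apply: (@murec_fold 1 _ _
  (fun v w => code_cons (code_commutator (code_head (nth 0 v 0)) w))).
- exact: hdP (tlP _ _ bodyP).
- apply: (murec3 murec_code_base); first exact: nP.
    exact: hdP (hdP _ _ bodyP).
  exact: hdP (tlP _ _ (hdP _ _ bodyP)).
- apply: (murec2 murec_cons) (murec_nth _ _).
  apply: (murec2 murec_code_commutator) (murec_nth _ _).
  exact: hdP (murec_nth_drop _ _ _).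
Qed.

End RopePresentationCode.

(** * The embedding of [T_ X] and the theorem *)

Lemma rope_relatorsP (n : nat) rels emb sub (G : groupType) (g : 'I_(n + 11) -> G)
    (gl := g \o @lshift n 11) (gr := g \o @rshift n 11) :
  (forall r, r \in tagged (rope_pres (existT _ n (rels, emb, sub))) -> word_eval g r = 1) <->
  [/\ [/\ gr (inord 0) = word_eval gl (nth [::] emb 0),
          gr (inord 1%N) = word_eval gl (nth [::] emb 1) &
          gr (inord 2) = word_eval gl (nth [::] emb 2)],
      rope_holds gr,
      forall r, r \in rels -> word_eval gl r = 1 &
      forall w, w \in sub -> commute (gr (inord 3)) (word_eval gl w)].
Proof.
have oldE w : word_eval g (old_word w) = word_eval gl w by exact: word_eval_map.
have newE w : word_eval g (new_word n w) = word_eval gr w by exact: word_eval_map.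
have VcatE i w : word_eval g (new_word n [:: letterV i] ++ old_word w) = 1 <->
    gr (inord i) = word_eval gl w.
  rewrite word_eval_cat newE oldE word_eval_cons word_eval_nil mulg1 /letter_eval /=.
  split=> [/(congr1 (fun x => gr (inord i) * x))|->]; last exact: mulVg.
  by rewrite mulVKg mulg1.
have commE w : word_eval g (rope_commutator w) = 1 <->
    commute (gr (inord 3)) (word_eval gl w).
  rewrite /rope_commutator !word_eval_cat !newE word_eval_inv oldE.
  rewrite !word_eval_cons !word_eval_nil !mulg1 /letter_eval /= -/(gr (inord 3)).
  split=> [/(congr1 (fun x => word_eval gl w * (gr (inord 3) * x)))|->].
    by rewrite mulVKg mulVKg mulg1.
  by rewrite mulKg mulVg.
(* The fold lists the commutators in reverse, which membership does not notice. *)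
have memE (r : word 'I_(n + 11)) : r \in tagged (rope_pres (existT _ n (rels, emb, sub))) =
    (r \in rope_base_relators rels emb) || (r \in map (@rope_commutator n) sub).
  rewrite /=; move: (rope_base_relators rels emb).
  elim: sub => [|w sub IHs] rs /=; first by rewrite orbF.
  by rewrite IHs !inE -orbA orbCA.
have baseE r : r \in rope_base_relators rels emb =
    [|| r == new_word n [:: letterV 0] ++ old_word (nth [::] emb 0),
        r == new_word n [:: letterV 1] ++ old_word (nth [::] emb 1),
        r == new_word n [:: letterV 2] ++ old_word (nth [::] emb 2),
        r \in map (new_word n) rope_relators | r \in map (@old_word n) rels].
  by rewrite -mem_cat -!in_cons.
split=> [gP|[[ga gb gc] /allP gr_rope g_rels g_comm] r].
  have baseP r : r \in rope_base_relators rels emb -> word_eval g r = 1.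
    by move=> rb; apply: gP; rewrite memE rb.
  split.
  - by split; apply/VcatE; apply: baseP; rewrite baseE eqxx ?orbT.
  - apply/allP => e e_eq; apply/eqP/word_eval_relator; rewrite -newE; apply: baseP.
    by rewrite baseE [_ \in map (new_word n) _]map_f ?orbT //; exact: map_f e_eq.
  - move=> r r_rels; rewrite -oldE; apply: baseP.
    by rewrite baseE (map_f (@old_word n) r_rels) !orbT.
  - by move=> w w_sub; apply/commE/gP; rewrite memE map_f ?orbT.
rewrite memE => /orP[|/mapP[w w_sub ->]]; last exact/commE/g_comm.
rewrite baseE => /or4P[/eqP->|/eqP->|/eqP->|/orP[]]; try exact/VcatE.
  move=> /mapP[_ /mapP[e e_eq ->] ->]; rewrite newE; apply/word_eval_relator/eqP.
  exact: gr_rope.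
by move=> /mapP[w w_rels ->]; rewrite oldE g_rels.
Qed.

(** By [rope_kills] the last two letters satisfy the relators of [T_ X], which gives [theta]; by
    [rope_model] the presented group maps to [M], and the composite with [theta] is the injective
    [thetaM]. [rope_relatorsP] serves in both directions: for the generators of the presented group
    and for their images in [M]. *)
Lemma rope_embeds (X : set E) (D : explicit_data) :
  explicit_for D (A_ X) -> embeds (T_ X) (group_of (rope_pres D)).
Proof.
case: D => n [[rels emb] sub] [phi [phi_inj phiE AL]].
set D := existT _ n _ in phi phi_inj phiE AL *.
set K := group_of (data_pres D) in phi phi_inj phiE AL *.
have sgL : is_subgroup (data_sub D) by exact: subgroup_gen_is_subgroup.
pose G := group_of (rope_pres D).
have := (rope_relatorsP rels emb sub (fun i => pres_gen i : G)).1.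
set gl := _ \o @lshift n 11; set gr := _ \o @rshift n 11.
case=> [r|[ga gb gc] /rope_holdsP gr_rope g_rels g_comm]; first exact: relator_eval.
have [kap kapE] : exists kap : {multiplicative K -> G}, forall i, kap (pres_gen i) = gl i.
  by apply: pres_group_lift => r; exact: g_rels.
have kap_word w : kap (word_class w) = word_eval gl w.
  by rewrite word_class_eval morph_word_eval; exact: eq_word_eval.
have embE i : i < 3 -> kap (phi (pres_gen (inord i))) = word_eval gl (nth [::] emb i).
  by move=> i3; rewrite phiE /data_emb kap_word (tnth_nth [::]) inordK.
have kills f : X f -> word_eval (pair2 (gr (inord 9)) (gr (inord 10))) (w_ f) = 1.
  move=> Xf; apply: (rope_kills (phi := kap \o phi) gr_rope) => /=.
  - by rewrite embE ?ga.
  - by rewrite embE ?gb.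
  - by rewrite embE ?gc.
  have : data_sub D (phi (a_fun f)).
    have : (phi @` A_ X) (phi (a_fun f)).
      by exists (a_fun f) => //; apply: sub_subgroup_gen; exists f.
    by rewrite AL => -[].
  (* The elements whose images commute with [t] form a subgroup containing the generators of [L]. *)
  apply: (subgroup_gen_min (commute_subgroup kap (gr (inord 3)))).
  by move=> _ [w w_sub <-] /=; rewrite kap_word; exact: g_comm.
have [theta thetaE] : exists theta : {multiplicative T_ X -> G},
    forall i, theta (pres_gen i) = pair2 (gr (inord 9)) (gr (inord 10)) i.
  by apply: pres_group_lift => _ [f Xf <-]; exact: kills.
have [M [kapM [thetaM [t [s [al [x [y [d [thetaM_inj tL ropeM]]]]]]]]]] :=
  rope_model phi_inj sgL AL.
(* Images of the eleven new letters in the order of [rope_eqs]; the default 1 below is never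
   reached. *)
pose lM := [:: kapM (phi F3a); kapM (phi F3b); kapM (phi F3c); t; s; al; x; y; d;
               thetaM (pres_gen ord0); thetaM (pres_gen ord_max)].
pose gM (i : 'I_(n + 11)) := match split i with
  inl j => kapM (pres_gen j) | inr k => nth 1 lM k end.
have gMl j : gM (lshift 11 j) = kapM (pres_gen j).
  by rewrite /gM (unsplitK (inl j : 'I_n + 'I_11)).
have gMr k : k < 11 -> gM (rshift n (inord k)) = nth 1 lM k.
  by move=> k11; rewrite /gM (unsplitK (inr (inord k) : 'I_n + 'I_11)) inordK.
have gM_word w : word_eval (gM \o @lshift n 11) w = kapM (word_class w).
  by rewrite word_class_eval morph_word_eval; exact: eq_word_eval.
have [psi psiE] : exists psi : {multiplicative G -> M}, forall i, psi (pres_gen i) = gM i.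
  apply: pres_group_lift => r; move: r; apply/rope_relatorsP; split.
  - by split; rewrite gM_word /= gMr //=; congr (kapM _);
      rewrite [LHS]phiE /data_emb (tnth_nth [::]) inordK.
  - by apply/rope_holdsP; rewrite /= !gMr.
  - by move=> r r_rels; rewrite gM_word word_class_eval relator_eval // group_morph1.
  - move=> w w_sub; rewrite gM_word /= gMr //=; apply: tL.
    by apply: sub_subgroup_gen; exists w.
exists theta => u v /(congr1 psi) uv; apply: thetaM_inj.
have psi_theta : psi \o theta =1 thetaM.
  apply: pres_morph_eq => i /=; rewrite thetaE /pair2; case: eqP => [->|/eqP i0].
    by rewrite psiE gMr.
  rewrite psiE gMr //=; congr (thetaM (pres_gen _)); apply/val_inj.
  by case: i i0 => [[|[|]]].
by rewrite -!psi_theta.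
Qed.

Lemma subgroup_gen_image (G H : groupType) (phi : {multiplicative G -> H}) (S : set G) :
  phi @` subgroup_gen S = subgroup_gen (phi @` S).
Proof.
have [S1 SD] := subgroup_gen_is_subgroup S.
have [T1 TD] := subgroup_gen_is_subgroup (phi @` S).
apply/seteqP; split.
  move=> _ [x Sx <-]; move: x Sx; apply: subgroup_gen_min => [|x Sx].
    split=> [|x y /= Tx Ty]; first by rewrite /= group_morph1.
    by rewrite /= gmulfM group_morphV; exact: TD.
  by apply: sub_subgroup_gen; exists x.
apply: subgroup_gen_min => [|_ [x Sx <-]].
  split=> [|_ _ [x Sx <-] [y Sy <-]]; first by exists 1; rewrite // group_morph1.
  by exists (x * y^-1); rewrite ?gmulfM ?group_morphV //; exact: SD.
by exists x => //; exact: sub_subgroup_gen.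
Qed.

(** An isomorphism with a presented group turns abstract witnesses into data: representing words are
    chosen for the images of [a], [b], [c] and of the generators of [L]. *)
Lemma benign_explicit (H : set F3) : benign H -> exists D, explicit_for D H.
Proof.
case=> K [phi [L [[[n rels] [psi psi_bij]] [s ->] phi_inj HL]]].
have psi_inj := bij_inj psi_bij.
pose emb := [tuple repr (psi (phi (pres_gen i))) | i < 3].
exists (existT _ n (rels, emb, [seq repr (psi x) | x <- s])), (psi \o phi); split.
- exact: inj_comp.
- by move=> i; rewrite /data_emb /= tnth_mktuple word_class_repr.
have -> : data_sub (existT _ n (rels, emb, [seq repr (psi x) | x <- s])) =
    psi @` subgroup_gen [set x | x \in s].
  rewrite subgroup_gen_image /data_sub /=; congr subgroup_gen; apply/seteqP; split.
    move=> _ [_ /mapP[x xs ->] <-]; exists x => //.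
    by rewrite word_class_repr.
  move=> _ [x xs <-]; exists (repr (psi x)); last exact: word_class_repr.
  exact: map_f.
rewrite -[LHS]image_comp HL; apply/seteqP; split.
  by move=> _ [x [[g _ gx] Lx] <-]; split; [exists g; rewrite //= gx | exists x].
move=> _ [[g _ <-] [x Lx /= xg]]; exists (phi g) => //; split; first by exists g.
by rewrite -(psi_inj _ _ xg).
Qed.

Theorem theoremB :
  (forall X : set E, benign (A_ X) ->
     exists G : groupType, finitely_presented G /\ embeds (T_ X) G) /\
  (exists e : mu_code, forall (X : set E) (D : explicit_data),
     explicit_for D (A_ X) ->
     exists P : fin_pres,
       mu_eval e [:: pickle D] (pickle P) /\ embeds (T_ X) (group_of P)).
Proof.
split=> [X /benign_explicit[D DX]|].
  exists (group_of (rope_pres D)); split; last exact: rope_embeds.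
  by exists (rope_pres D), idfun; exists idfun.
(* [rope_pres D] does not involve [X], so one code serves all [X] and [D]. *)
have [e eP] := murec_code_rope.
exists e => X D DX; exists (rope_pres D); split; last exact: rope_embeds.
by rewrite -code_ropeE; exact: (eP [:: pickle D]).
Qed.
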